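(* Let $n\ge 2$ be a prime power, and let $GK$ be the Giulietti--Korchmáros curve over $\mathbb{F}_{n^6}$, of genus $g$, with point at infinity $P_\infty$ and points $P_1,\dots,P_n$, where $P_j=(a_j,0,0)$ and $a_1,\dots,a_n$ are the distinct roots of $X^n+X=0$. Put $a=n^2-n+1$, $b=n^3$, $c=n^3+1$, and let $1\le m\le n$. Let $\alpha<2g-1$ with $(\alpha,1,1,\ldots,1)\in G(P_\infty,P_1,\ldots,P_m)$. If either (i) there exist $\lambda,\beta,\gamma\in\mathbb{N}_0$ with $\lambda\ge m$ such that $\lambda c+\beta an+\gamma b=2g-1-\alpha$, or (ii) $2g-1-\alpha\ge (m-1)c$ and there exist $\beta,\gamma\in\mathbb{N}_0$ such that $\beta an+\gamma b=2g-1-\alpha$, then $(\alpha,1,1,\ldots,1)$ is a pure gap at $P_\infty,P_1,\ldots,P_m$.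
   Context: The $GK$ curve. Let $n\ge2$ be a prime power and $q=n^3$. $GK$ is the nonsingular, absolutely irreducible projective curve in $\mathbb{P}^3$ over $\mathbb{F}_{q^2}=\mathbb{F}_{n^6}$ with affine equations $Z^{n^2-n+1}=Y\,h(X)$, $X^n+X=Y^{n+1}$, where $h(X)=\sum_{i=0}^{n}(-1)^{i+1}X^{i(n-1)}$. It has a single point at infinity $P_\infty=(1:0:0:0)$ and genus $g=\frac12(n^3+1)(n^2-2)+1$. Its function field is $\mathbb{F}_{q^2}(x,y,z)$ with $z^{n^2-n+1}=y\,h(x)$ and $x^n+x=y^{n+1}$. For $j=1,\dots,n$, $P_j=(a_j,0,0)$ with $a_j^n+a_j=0$ (all $n$ such points, which are $\mathbb{F}_{q^2}$-rational). For a divisor $G$ on a curve $\mathcal{X}$ over a finite field $F$, $\mathcal{L}(G)=\{f\in F(\mathcal{X}) : (f)+G\ge0\}\cup\{0\}$ is the Riemann--Roch space. Weierstrass semigroup and gaps. For distinct rational points $R_1,\dots,R_r$ on $\mathcal{X}$, $H(R_1,\dots,R_r)=\{(u_1,\dots,u_r)\in\mathbb{N}_0^r : \exists f\in F(\mathcal{X}) \text{ with pole divisor } (f)_\infty=\sum_i u_iR_i\}$, where $\mathbb{N}_0$ is the set of nonnegative integers; the gap set is $G(R_1,\dots,R_r)=\mathbb{N}_0^r\setminus H(R_1,\dots,R_r)$. Pure gap. An element $(\alpha_1,\dots,\alpha_r)\in G(R_1,\dots,R_r)$ is a pure gap (of $H(R_1,\dots,R_r)$, or at $R_1,\dots,R_r$)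 if $\dim\mathcal{L}(\sum_{i}\alpha_iR_i)=\dim\mathcal{L}(\sum_{i}\alpha_iR_i-R_j)$ for all $j=1,\dots,r$. *)

(* Defs.v *)
From HB Require Import structures.
From mathcomp Require Import all_boot all_order all_algebra.
From mathcomp Require Import mathcomp_extra boolp classical_sets functions.

Set Implicit Arguments.
Unset Strict Implicit.
Unset Printing Implicit Defensive.

Import Order.TTheory GRing.Theory Num.Theory.
Local Open Scope ring_scope.

(* Function fields are treated as in Stichtenoth: a curve over K is given by a
   field F with an embedding iota : K -> F, and its (closed) points are the
   places of F / K, i.e. the normalized discrete valuations trivial on K. *)
Section FunctionField.
Context (K F : fieldType) (iota : {rmorphism K -> F}).

(* The order of 0 should be +oo; the value 0 is a dummy, fixed so that equality
   of places is equality of valuations. Every use of [ord P f] below treats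
   f = 0 separately. *)
Record place := Place {
  ord :> F -> int;
  ord0_dummy : ord 0 = 0;
  ordM : forall f g, f != 0 -> g != 0 -> ord (f * g) = ord f + ord g;
  ordD : forall f g, f != 0 -> g != 0 -> f + g != 0 ->
    Num.min (ord f) (ord g) <= ord (f + g);
  ord_const : forall c, c != 0 -> ord (iota c) = 0;
  ord_normalized : exists2 t, t != 0 & ord t = 1
}.

Definition vanishes_at (P : place) (f : F) : Prop := f = 0 \/ 0 < P f.

(* P lies over the K-rational point (c_0 : ... : c_r) of projective space, where
   xi are the homogeneous coordinate functions: in some affine chart xi_k <> 0
   containing the point, each xi_i / xi_k takes the value c_i / c_k at P. *)
Definition centered_at r (P : place) (xi : r.-tuple F) (c : r.-tuple K) : Prop :=
  exists k : 'I_r, [/\ tnth xi k != 0, tnth c k != 0 &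
    forall i : 'I_r,
      vanishes_at P (tnth xi i / tnth xi k - iota (tnth c i / tnth c k))].

(* Only finite integer combinations of [point_div] are ever used. *)
Definition divisor := place -> int.

Definition point_div (P : place) : divisor := fun Q => (`[< Q = P >] : nat)%:Z.

Definition div_of r (R : 'I_r -> place) (u : 'I_r -> nat) : divisor :=
  \sum_(i < r) point_div (R i) *+ u i.

Definition RRspace (G : divisor) : set F :=
  [set f | f = 0 \/ forall P : place, 0 <= P f + G P].

Definition pole_div (f : F) : divisor := fun P => Num.max 0 (- P f).

Definition has_dim (V : set F) (d : nat) : Prop :=
  exists e : 'I_d -> F,
    [/\ forall i, V (e i),
        forall c : 'I_d -> K,
          \sum_(i < d) iota (c i) * e i = 0 -> forall i, c i = 0
      & forall f, V f ->
          exists c : 'I_d -> K, f = \sum_(i < d) iota (c i) * e i].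

Definition Wsemigroup r (R : 'I_r -> place) : set ('I_r -> nat) :=
  [set u | exists2 f : F, f != 0 & pole_div f = div_of R u].

Definition gaps r (R : 'I_r -> place) : set ('I_r -> nat) :=
  (~` Wsemigroup R)%classic.

Definition pure_gap r (R : 'I_r -> place) (u : 'I_r -> nat) : Prop :=
  gaps R u /\
  forall j : 'I_r, exists2 d : nat,
    has_dim (RRspace (div_of R u)) d
    & has_dim (RRspace (div_of R u - point_div (R j))) d.

End FunctionField.

(* The family (t_0, t_1, ..., t_m) with head t_0 and tail t. *)
Definition fcons T m (t0 : T) (t : 'I_m -> T) : 'I_m.+1 -> T :=
  fun i => if unlift ord0 i is Some j then t j else t0.

Definition GK_h (R : nzRingType) (n : nat) (X : R) : R :=
  \sum_(i < n.+1) (-1) ^+ i.+1 * X ^+ (i * (n - 1)).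

(* F is the function field K(x, y, z) of the GK curve. The affine equations
   define an irreducible curve, so they determine (F, x, y, z) once x is
   transcendental over K; the last clause is F = K(x, y, z): no proper subfield
   contains K, x, y and z. *)
Record GK_function_field (n : nat) (K F : fieldType) (iota : {rmorphism K -> F})
    (x y z : F) : Prop := {
  GK_eq_z : z ^+ (n ^ 2 - n + 1) = y * GK_h n x;
  GK_eq_y : x ^+ n + x = y ^+ n.+1;
  GK_transcendental : ~ algebraicOver iota x;
  GK_generated : forall S : {pred F}, divring_closed S ->
    (forall c, iota c \in S) -> x \in S -> y \in S -> z \in S ->
    forall f, f \in S
}.

(* The genus of GK as computed by Giulietti and Korchmaros. The halving is exact:
   (n^3 + 1)(n^2 - 2) is even for n >= 2. *)
Definition GK_genus (n : nat) : nat := (((n ^ 3 + 1) * (n ^ 2 - 2))./2 + 1)%N.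

(* Main.v *)
Require Import Defs.
From HB Require Import structures.
From mathcomp Require Import all_boot all_order all_algebra.
From mathcomp Require Import mathcomp_extra boolp classical_sets functions.
From mathcomp Require Import qfpoly finfield zify ring.

Set Implicit Arguments.
Unset Strict Implicit.
Unset Printing Implicit Defensive.

Import Order.TTheory GRing.Theory Num.Theory.
Local Open Scope ring_scope.

(** On GK, dz has divisor (2g - 2) Pinf. Hence a function h in L(G) outside
    L(G - Q), multiplied by a function f with suitable zeros and poles, would
    turn dz into a differential h f dz with a single simple pole, against the
    residue theorem. Two special cases of that theorem suffice: no function has
    polar divisor (2g - 1) Pinf, and a function in L((2g - 2) Pinf + P_j) is
    regular at P_j.

    Both are obtained inside the coordinate ring A = K[x, y, z]. As
    z^(n^2-n+1) = y^(n^2) - y and x^n + x = y^(n+1), the monomials z^k y^j x^i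
    with j < n^2 and i < n span A, and their orders at Pinf are pairwise
    distinct. The two equations are additive in y and x, so a power of Frobenius
    fixes A/pA for every irreducible p in K[z]; therefore p is a local parameter
    at every prime of A above it, each such prime defines a place, and A consists
    of the functions regular away from Pinf. *)

(** * Places *)

(** A function of [L(G)] may have a pole of order [alpha] at [Pinf] and simple poles at the [P_i].
    To exclude order exactly [alpha] at [Pinf], multiply by some [t] that vanishes at all [P_i] and
    has pole order [2g - 1 - alpha]: the product would have pole order [2g - 1]. In case (i), [m] of
    the [lambda] factors [x] are replaced by the [x - a_i]; in case (ii), [y] and [z] already vanish
    at every [P_i]. To exclude a pole at [P_i], multiply by the other [m - 1] factors [x - a_k]; the
    pole order at [Pinf] stays at most [2g - 2] if [(m - 1) c < 2g - 1 - alpha], so equality in (ii)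
    must be ruled out separately. The obstacle is that places are arbitrary valuations: showing that
    a function without finite poles lies in [A] requires producing a place at each would-be pole.
    The congruence [f^N = f] modulo [p] makes [A/pA] reduced with all primes maximal, so that
    localizing [A] at such a prime yields a discrete valuation directly. *)

Section PlaceTheory.
Context (K F : fieldType) (iota : {rmorphism K -> F}).
Implicit Types (v w : place iota) (f g : F).

Lemma place_eq v w : (forall f, f != 0 -> v f = w f) -> v = w.
Proof.
case: v w => [v v0 v1 v2 v3 v4] [w w0 w1 w2 w3 w4] /= vw.
have {}vw : v = w.
  by apply/funext => f; have [->|/vw//] := eqVneq f 0; rewrite v0 w0.
by subst w; congr Place; apply: Prop_irrelevance.
Qed.

Lemma ord1 v : v 1 = 0.
Proof. by rewrite -(rmorph1 iota) ord_const ?oner_eq0. Qed.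

Lemma ord_iota v c : v (iota c) = 0.
Proof.
by have [->|/ord_const//] := eqVneq c 0; rewrite rmorph0 ord0_dummy.
Qed.

Lemma ordN v f : v (- f) = v f.
Proof.
have [->|f0] := eqVneq f 0; first by rewrite oppr0.
by rewrite -mulN1r ordM ?oppr_eq0 ?oner_eq0 // -(rmorphN1 iota) ord_iota add0r.
Qed.

Lemma ordX v f k : v (f ^+ k) = v f *+ k.
Proof.
have [->|f0] := eqVneq f 0.
  by rewrite expr0n ord0_dummy mul0rn; case: k => [|k] /=; rewrite ?ord1 ?ord0_dummy.
elim: k => [|k IH]; first by rewrite ord1.
by rewrite exprS ordM ?expf_neq0 // IH mulrS.
Qed.

Lemma ordXz v f k : v (f ^+ k) = v f * k%:Z.
Proof. by rewrite ordX -mulr_natr natz. Qed.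

Lemma ordV v f : v f^-1 = - v f.
Proof.
have [->|f0] := eqVneq f 0; first by rewrite invr0 ord0_dummy.
apply/eqP; rewrite -addr_eq0; apply/eqP.
by rewrite -ordM ?invr_eq0 // mulVf // ord1.
Qed.

Lemma ordD_lt v f g : f != 0 -> (g != 0 -> v f < v g) ->
  f + g != 0 /\ v (f + g) = v f.
Proof.
move=> f0; have [->|g0 /(_ isT) fg] := eqVneq g 0; first by rewrite addr0.
have s0 : f + g != 0.
  apply/negP => /eqP/addr0_eq E; move: fg.
  by rewrite -E ordN ltxx.
split => //; have := ordD v f0 g0 s0; rewrite (min_idPl (ltW fg)) => le1.
apply/eqP; rewrite eq_le le1 andbT leNgt; apply/negP => lt1.
have ng0 : - g != 0 by rewrite oppr_eq0.
have fE : (f + g) + - g = f by rewrite addrK.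
have := ordD v s0 ng0; rewrite fE ordN => /(_ f0).
by rewrite leNgt lt_min lt1 fg.
Qed.

Lemma regularD v f g : 0 <= v f -> 0 <= v g -> 0 <= v (f + g).
Proof.
have [->|f0] := eqVneq f 0; first by rewrite add0r.
have [->|g0] := eqVneq g 0; first by rewrite addr0.
have [->|s0] := eqVneq (f + g) 0; first by rewrite ord0_dummy.
by move=> vf vg; apply: le_trans (ordD v f0 g0 s0); rewrite le_min vf.
Qed.

Lemma regularM v f g : 0 <= v f -> 0 <= v g -> 0 <= v (f * g).
Proof.
have [->|f0] := eqVneq f 0; first by rewrite mul0r ord0_dummy.
have [->|g0] := eqVneq g 0; first by rewrite mulr0 ord0_dummy.
by move=> vf vg; rewrite ordM ?addr_ge0.
Qed.

Lemma regularX v f k : 0 <= v f -> 0 <= v (f ^+ k).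
Proof. by rewrite ordX; exact: mulrn_wge0. Qed.

Lemma ord_prod v (I : Type) (t : seq I) (P : pred I) (G : I -> F) :
  (forall i, P i -> G i != 0) -> \prod_(i <- t | P i) G i != 0 /\
    v (\prod_(i <- t | P i) G i) = \sum_(i <- t | P i) v (G i).
Proof.
move=> G0; apply: (big_ind2 (fun f k => f != 0 /\ v f = k)) => //.
- by rewrite oner_eq0 ord1.
- by move=> f k g l [f0 <-] [g0 <-]; rewrite mulf_neq0 // ordM.
- by move=> i Pi; rewrite G0.
Qed.

Lemma vanishesD v f g :
  vanishes_at v f -> vanishes_at v g -> vanishes_at v (f + g).
Proof.
move=> [->|vf]; first by rewrite add0r.
move=> [->|vg]; first by rewrite addr0; right.
have [->|f0] := eqVneq f 0; first by rewrite add0r; right.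
have [->|g0] := eqVneq g 0; first by rewrite addr0; right.
have [->|s0] := eqVneq (f + g) 0; [by left | right].
by apply: lt_le_trans (ordD v f0 g0 s0); rewrite lt_min vf.
Qed.

Lemma vanishesM v f g : vanishes_at v f -> 0 <= v g -> vanishes_at v (f * g).
Proof.
move=> [->|vf] vg; first by left; rewrite mul0r.
have [->|f0] := eqVneq f 0; first by left; rewrite mul0r.
have [->|g0] := eqVneq g 0; first by left; rewrite mulr0.
by right; rewrite ordM // ltr_wpDr.
Qed.

Lemma vanishesN v f : vanishes_at v f -> vanishes_at v (- f).
Proof. by move=> [->|vf]; [left; rewrite oppr0 | right; rewrite ordN]. Qed.

Lemma vanishes_regular v f : vanishes_at v f -> 0 <= v f.
Proof. by move=> [->|/ltW//]; rewrite ord0_dummy. Qed.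

Lemma vanishes_iota v c : vanishes_at v (iota c) -> c = 0.
Proof.
move=> [/eqP|]; first by rewrite fmorph_eq0 => /eqP.
by rewrite ord_iota ltxx.
Qed.

Lemma ord_sum_distinct v (I : finType) (G : I -> F) :
  (forall i j, G i != 0 -> G j != 0 -> v (G i) = v (G j) -> i = j) ->
  (exists i, G i != 0) ->
  exists i, [/\ G i != 0, \sum_j G j != 0, v (\sum_j G j) = v (G i)
    & forall j, G j != 0 -> v (G i) <= v (G j)].
Proof.
move=> inj [i0 Gi0].
have [i Gi imin] : exists2 i, G i != 0 & forall j, G j != 0 -> v (G i) <= v (G j).
  by case: (@arg_minP _ _ _ i0 (fun i => G i != 0) (fun i => v (G i)) Gi0) => i Gi H; exists i.
exists i; rewrite (bigD1 i) //=.
have key : \sum_(j | j != i) G j != 0 -> v (G i) < v (\sum_(j | j != i) G j).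
  apply: (big_ind (fun s => s != 0 -> v (G i) < v s)); first by rewrite eqxx.
  - move=> a b Ha Hb s0.
    have [a0|a0] := eqVneq a 0; first by rewrite a0 add0r in s0 *; exact: Hb.
    have [b0|b0] := eqVneq b 0; first by rewrite b0 addr0 in s0 *; exact: Ha.
    by apply: lt_le_trans (ordD v a0 b0 s0); rewrite lt_min Ha ?Hb.
  - move=> j ji Gj; rewrite lt_def imin // andbT.
    by apply: contra ji => /eqP/(inj _ _ Gj Gi) ->.
by have [-> ->] := ordD_lt Gi key.
Qed.

(** At a pole of [f] the monomials of [q(f)] have distinct orders and the leading one dominates; in
    particular [f] is transcendental over [K]. *)
Lemma ord_horner v f (q : {poly K}) : v f < 0 -> q != 0 ->
  (map_poly iota q).[f] != 0 /\ v (map_poly iota q).[f] = v f *+ (size q).-1.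
Proof.
move=> vf q0; have f0 : f != 0 by apply/negP => /eqP E; rewrite E ord0_dummy in vf.
rewrite horner_coef size_map_poly.
pose G (i : 'I_(size q)) := (map_poly iota q)`_i * f ^+ i.
have GE (i : 'I_(size q)) : q`_i != 0 -> G i != 0 /\ v (G i) = v f *+ i.
  move=> qi; rewrite /G coef_map mulf_neq0 ?fmorph_eq0 ?expf_neq0 //.
  by rewrite ordM ?fmorph_eq0 ?expf_neq0 // ord_iota add0r ordX.
have Gn0 (i : 'I_(size q)) : G i != 0 -> q`_i != 0.
  by rewrite /G coef_map; apply: contraNneq => ->; rewrite mulf_eq0 fmorph_eq0 eqxx.
have sq : ((size q).-1 < size q)%N by rewrite prednK // size_poly_gt0.
case: (@ord_sum_distinct v _ G).
- move=> i j /Gn0 /GE[_ ->] /Gn0 /GE[_ ->]; rewrite -![v f *+ _]mulr_natr !natz.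
  by move/(mulfI (ltr0_neq0 vf)) => [E]; apply/val_inj.
- by exists (Ordinal sq); have [] := GE (Ordinal sq); rewrite //= -/(lead_coef q) lead_coef_eq0.
move=> i [Gi S0 vS imin]; split => //; rewrite vS.
have [_ vGi] := GE _ (Gn0 _ Gi).
have [G1 vG1] : G (Ordinal sq) != 0 /\ v (G (Ordinal sq)) = v f *+ (size q).-1.
  by apply: GE; rewrite //= -/(lead_coef q) lead_coef_eq0.
apply/eqP; rewrite eq_le; apply/andP; split; first by rewrite -vG1 imin.
rewrite vGi; have : (i <= (size q).-1)%N by have := ltn_ord i; lia.
by rewrite -![v f *+ _]mulr_natr !natz; nia.
Qed.

End PlaceTheory.
(** * Weights at infinity and polynomials over finite fields *)

Lemma double_GK_genus n : (2 <= n)%N ->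
  (2 * GK_genus n - 1 = (n ^ 3 + 1) * (n ^ 2 - 2) + 1)%N.
Proof.
move=> n2; rewrite /GK_genus.
have ev : ~~ odd ((n ^ 3 + 1) * (n ^ 2 - 2)).
  rewrite oddM oddD oddB ?oddX; last by rewrite expnS expn1; nia.
  by case: (odd n).
move: ((_ * _)%N) ev => N ev; have := odd_double_half N; rewrite (negbTE ev) -muln2; lia.
Qed.

Lemma coprime_GKexp n : (2 <= n)%N -> coprime (n ^ 2 - n + 1) n.
Proof.
move=> n2; have -> : (n ^ 2 - n + 1 = (n - 1) * n + 1)%N by rewrite expnS expn1; nia.
by rewrite coprime_sym /coprime gcdnMDl gcdn1.
Qed.

Lemma GKexp_mul n : (2 <= n)%N -> ((n ^ 2 - n + 1) * n.+1 = n ^ 3 + 1)%N.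
Proof.
move=> n2; rewrite !expnS expn0 muln1; have : (n <= n * n)%N by nia.
by nia.
Qed.

(* 2g - 1 is the Frobenius number of the Weierstrass semigroup at infinity. *)
Lemma GK_frobenius n l be ga : (2 <= n)%N ->
  (l * (n ^ 3 + 1) + be * ((n ^ 2 - n + 1) * n) + ga * n ^ 3
   <> 2 * GK_genus n - 1)%N.
Proof.
move=> n2; rewrite double_GK_genus // -GKexp_mul // => E.
have := coprime_GKexp n2; have := GKexp_mul n2.
have : (0 < n ^ 2 - n + 1)%N by lia.
move: E; set a := (n ^ 2 - n + 1)%N => E a0 aE co.
have n22 : (n ^ 2 - 2 + 2 = n ^ 2)%N by rewrite expnS expn1; nia.
(* Adding [c + b] to both sides turns [2g - 1] into [n^2 c = a (n^2 + n^3)], which exposes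
   divisibility by [a], and later by [n]. *)
have E' : (l.+1 * (a * n.+1) + be * (a * n) + ga.+1 * n ^ 3
           = a * (n ^ 2 + n ^ 3))%N.
  have -> : (a * (n ^ 2 + n ^ 3) = a * n.+1 * n ^ 2)%N by rewrite expnS; ring.
  rewrite -n22 mulnDr; have -> : (l.+1 * (a * n.+1) + be * (a * n) + ga.+1 * n ^ 3
    = l * (a * n.+1) + be * (a * n) + ga * n ^ 3 + (a * n.+1 + n ^ 3))%N by ring.
  by rewrite E; move: aE; lia.
have /dvdnP[t tE] : (a %| ga.+1)%N.
  rewrite -(@Gauss_dvdl _ _ (n ^ 3)) ?coprimeXr //.
  rewrite -(@dvdn_addr (l.+1 * (a * n.+1) + be * (a * n))%N).
    by rewrite E' dvdn_mulr.
  by rewrite dvdn_add // mulnCA dvdn_mulr.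
have {}E' : (l.+1 * n.+1 + be * n + t * n ^ 3 = n ^ 2 + n ^ 3)%N.
  by apply/eqP; rewrite -(eqn_pmul2l a0) -E' tE; apply/eqP; ring.
have n3 : (n ^ 3 = n * n ^ 2)%N by rewrite expnS.
have n2E : (n ^ 2 = n * n)%N by rewrite expnS expn1.
have t1 : t = 1%N.
  case: t tE E' => [|[|t]] // _; rewrite n3 n2E; have : (n * n < n * (n * n))%N.
    by rewrite ltn_Pmull // muln_gt0; lia.
  move: (n * (n * n))%N (n * n)%N => N3 N2; rewrite (mulSn t.+1) (mulSn t).
  by move: (t * N3)%N (l.+1 * n.+1)%N (be * n)%N => *; lia.
have {}E' : (l.+1 * n.+1 + be * n = n * n)%N by rewrite t1 in E'; lia.
(* Since [n] divides [l + 1 > 0], the first term is at least [n (n + 1) > n^2]. *)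
have /dvdnP[s sE] : (n %| l.+1)%N.
  have D : (n %| l.+1 * n.+1 + be * n)%N by rewrite E' dvdn_mulr.
  move: D; rewrite dvdn_addl; last exact: dvdn_mull.
  by rewrite Gauss_dvdl ?coprimenS.
case: s sE => [|s] sE //; move: E'; rewrite sE mulSn mulnDl (mulnS n).
by move: (n * n)%N (_ * n.+1)%N (be * n)%N => M3 M2 M1; lia.
Qed.

(** As [c] is 1 modulo [n] and the other two weights are 0, reduction modulo [n] recovers [i]. After
    division by [n], reduction modulo [n^2] recovers [j], because [a] is prime to [n]. *)
Lemma GK_weight_inj n k j i k' j' i' : (2 <= n)%N ->
  (i < n)%N -> (i' < n)%N -> (j < n ^ 2)%N -> (j' < n ^ 2)%N ->
  (k * n ^ 3 + j * ((n ^ 2 - n + 1) * n) + i * (n ^ 3 + 1)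
   = k' * n ^ 3 + j' * ((n ^ 2 - n + 1) * n) + i' * (n ^ 3 + 1))%N ->
  i = i' /\ j = j'.
Proof.
move=> n2 i_n i'_n jn j'n; have := coprime_GKexp n2.
set a := (n ^ 2 - n + 1)%N => co E.
have n3 : (n ^ 3 = n ^ 2 * n)%N by rewrite expnSr.
have ii' : i = i'.
  have R k1 j1 i1 : (k1 * n ^ 3 + j1 * (a * n) + i1 * (n ^ 3 + 1) =
      (k1 * n ^ 2 + j1 * a + i1 * n ^ 2) * n + i1)%N by rewrite n3; ring.
  move/(congr1 (modn^~ n)): E.
  by rewrite !R !modnMDl !modn_small.
split=> //; subst i'; move/addIn: E.
have R k1 j1 : (k1 * n ^ 3 + j1 * (a * n) = (k1 * n ^ 2 + j1 * a) * n)%N.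
  by rewrite n3; ring.
rewrite !R => /eqP; rewrite eqn_pmul2r; last by lia.
move=> /eqP/(congr1 (modn^~ (n ^ 2)%N)); rewrite !modnMDl => /eqP.
have co2 : coprime (n ^ 2) a by rewrite coprimeXl // coprime_sym.
wlog le : j j' jn j'n {R} / (j <= j')%N => [H|].
  have [/H|/ltnW/H H'] := leqP j j'; first by apply.
  by rewrite eq_sym => /H' ->.
rewrite eq_sym eqn_mod_dvd ?leq_mul2r ?le ?orbT // -mulnBl Gauss_dvdl //.
move=> D; apply/eqP; rewrite eqn_leq le /= -subn_eq0.
by have [//|/dvdn_leq/(_ D)] := posnP (j' - j); lia.
Qed.

(** Every element of the residue field [K[X]/p], in particular the class of ['X], is fixed by the
    power given by the order of that field. The quotient is formed with the monic multiple [h] of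
    [p]. *)
Lemma irreducible_dvdp_XcardX (K : finFieldType) (p : {poly K}) :
  irreducible_poly p -> p %| 'X^(#|K| ^ (size p).-1) - 'X.
Proof.
move=> irr; pose h := (lead_coef p)^-1 *: p.
have lp0 : (lead_coef p)^-1 != 0 by rewrite invr_eq0 lead_coef_eq0 irredp_neq0.
have hI : monic_irreducible_poly h.
  split; last by rewrite monicE lead_coefZ mulVf // -invr_eq0.
  split; first by rewrite size_scale //; case: irr.
  move=> q sq; rewrite dvdpZr // => /(irr _ sq) qp.
  by apply: eqp_trans qp _; rewrite eqp_sym eqp_scale.
rewrite -(dvdpZl _ _ lp0) -/h -(size_scale p lp0) -/h -(card_qfpoly hI).
have E := @expf_card {poly %/ h with hI} (in_qpoly h 'X).
set M := #|_| in E *.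
have : in_qpoly h ('X^M - 'X) = 0.
  by rewrite rmorphB rmorphXn; apply/eqP; rewrite subr_eq0; apply/eqP.
move/(congr1 val); rewrite /= (mk_monicE hI) => E0.
by rewrite dvdpE /Pdiv.Ring.rdvdp E0.
Qed.

Lemma irreducible_factor (K : fieldType) (q : {poly K}) : (1 < size q)%N ->
  exists2 p, irreducible_poly p & p %| q.
Proof.
have [N] := ubnP (size q); elim: N q => // N IH q; rewrite ltnS => sqN sq.
have [irr|nirr] := pselect (irreducible_poly q); first by exists q.
have q0 : q != 0 by rewrite -size_poly_gt0 ltnW.
have [d [sd dq ndq]] : exists d : {poly K}, [/\ size d != 1, d %| q & ~~ (d %= q)].
  apply: contrapT => H; apply: nirr; split=> // d sd dq.
  by apply/negPn/negP => nd; apply: H; exists d.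
have d0 : d != 0 by apply: contraNneq q0 => d0; rewrite -dvd0p -d0.
have ltd : (size d < size q)%N.
  by rewrite ltn_neqAle dvdp_leq // andbT; apply: contra ndq; rewrite -dvdp_size_eqp.
have [||p irr pd] := IH d.
- exact: leq_trans ltd sqN.
- by move: sd d0; rewrite -size_poly_gt0; case: (size d) => [|[|]].
- by exists p => //; exact: dvdp_trans pd dq.
Qed.

(** The left side is the pole order of [y^(n^2-1) x^(n-1)], the top monomial of the normal form;
    dividing it by [z] leaves exactly [2g - 1]. *)
Lemma GK_top_weight n : (2 <= n)%N ->
  ((n ^ 2 - 1) * ((n ^ 2 - n + 1) * n) + (n - 1) * (n ^ 3 + 1)
   = 2 * GK_genus n - 1 + n ^ 3)%N.
Proof.
move=> n2; rewrite double_GK_genus //.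
case: n n2 => [|[|k]] // _; rewrite !expnS !expn0 !muln1.
have -> : (k.+2 * k.+2 - k.+2 = k.+2 * k.+1)%N by nia.
have -> : (k.+2 * k.+2 - 1 = k * k + 4 * k + 3)%N by nia.
have -> : (k.+2 * k.+2 - 2 = k * k + 4 * k + 2)%N by nia.
have -> : (k.+2 - 1 = k.+1)%N by lia.
by ring.
Qed.

(** Modulo [n] the left side is [m] and the right side is 0. This serves the boundary case of
    hypothesis (ii). *)
Lemma GK_weight_boundary n m be ga : (m < n)%N ->
  (m * (n ^ 3 + 1) = be * ((n ^ 2 - n + 1) * n) + ga * n ^ 3)%N -> m = 0%N.
Proof.
move=> mn E; have : (n %| m)%N.
  rewrite -(@dvdn_addr (m * n ^ 3)%N) ?dvdn_mull ?dvdn_exp //.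
  rewrite -[X in (_ + X)%N]muln1 -mulnDr E.
  by apply: dvdn_add; [rewrite mulnA dvdn_mull | rewrite dvdn_mull ?dvdn_exp].
by case: m mn {E} => // m mn /dvdn_leq => /(_ isT); lia.
Qed.

(** * Finite-dimensional Riemann-Roch spaces *)

Section FiniteDimension.
Context (K : finFieldType) (F : fieldType) (iota : {rmorphism K -> F}).

(** As [K] is finite, [W] has finitely many elements and is spanned by all of them; a spanning
    family of minimal length is independent. *)
Lemma has_dim_finite_span (I : finType) (e : I -> F) (W : set F) :
  W 0 -> (forall f g, W f -> W g -> W (f + g)) ->
  (forall c f, W f -> W (iota c * f)) ->
  (forall f, W f -> exists c : I -> K, f = \sum_i iota (c i) * e i) ->
  exists d, has_dim iota W d.
Proof.
move=> W0 WD WM We.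
pose spans d := exists2 e' : 'I_d -> F, forall i, W (e' i) &
  forall f, W f -> exists c : 'I_d -> K, f = \sum_i iota (c i) * e' i.
have [d0 sd0] : exists d, spans d.
  pose g (c : {ffun I -> K}) := \sum_i iota (c i) * e i.
  exists #|{ffun I -> K}|.
  exists (fun k => if `[< W (g (enum_val k)) >] then g (enum_val k) else 0).
    by move=> k; case: ifP => // /asboolP.
  move=> f Wf; have [c fE] := We f Wf.
  have gE : g [ffun i => c i] = f by rewrite fE; apply: eq_bigr => i _; rewrite ffunE.
  exists (fun k => (k == enum_rank [ffun i => c i])%:R).
  rewrite (bigD1 (enum_rank [ffun i => c i])) //= big1 => [|k /negPf ->].
    by rewrite eqxx rmorph1 mul1r addr0 enum_rankK gE asboolT.
  by rewrite rmorph0 mul0r.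
have exd : exists d, `[< spans d >] by exists d0; apply/asboolP.
case: (ex_minnP exd) => d /asboolP[e' We' spane'] dmin.
exists d, e'; split=> // c cE k; apply/eqP/negPn/negP => ck.
case: d e' We' spane' dmin c cE k ck => [|d] e' We' spane' dmin c cE k ck.
  by case: k ck.
suff /asboolP/dmin : spans d by rewrite ltnn.
exists (fun i => e' (lift k i)) => // f /spane'[s ->].
exists (fun i => s (lift k i) - s k / c k * c (lift k i)).
have -> : \sum_i iota (s i) * e' i =
    \sum_i iota (s i - s k / c k * c i) * e' i.
  have H : \sum_i iota (s k / c k) * (iota (c i) * e' i) = 0.
    by rewrite -mulr_sumr cE mulr0.
  rewrite [RHS](eq_bigr (fun i => iota (s i) * e' i -
    iota (s k / c k) * (iota (c i) * e' i))) => [|i _].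
    by rewrite sumrB H subr0.
  by rewrite rmorphB rmorphM /=; ring.
by rewrite (bigD1_ord k) //= divfK // subrr rmorph0 mul0r add0r.
Qed.

Lemma has_dim_RRspace (I : finType) (e : I -> F) (G : divisor iota) :
  (forall f, RRspace G f -> exists c : I -> K, f = \sum_i iota (c i) * e i) ->
  exists d, has_dim iota (RRspace G) d.
Proof.
move=> Ge; apply: has_dim_finite_span Ge; first by left.
- move=> f g; have [->|f0] := eqVneq f 0; first by rewrite add0r.
  have [->|g0] := eqVneq g 0; first by rewrite addr0.
  have [->|s0] := eqVneq (f + g) 0; first by left.
  move=> [/eqP|Gf]; first by rewrite (negPf f0).
  move=> [/eqP|Gg]; first by rewrite (negPf g0).
  right=> v; have := Gf v; have := Gg v; have := ordD v f0 g0 s0.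
  by rewrite ge_min => /orP[]; move: (v f) (v g) (v (f + g)) (G v) => A B C D; lia.
- move=> c f [->|Gf]; first by left; rewrite mulr0.
  have [->|c0] := eqVneq c 0; first by left; rewrite rmorph0 mul0r.
  have [->|f0] := eqVneq f 0; first by left; rewrite mulr0.
  by right=> v; rewrite ordM ?fmorph_eq0 // ord_iota add0r.
Qed.

Lemma div_ofE r (R : 'I_r -> place iota) (u : 'I_r -> nat) v :
  div_of R u v = \sum_(i < r) (`[< v = R i >] * u i)%N%:Z.
Proof.
rewrite /div_of fct_sumE; apply: eq_bigr => i _.
have natmulE (f : divisor iota) k : (f *+ k) v = f v *+ k.
  by elim: k => // k IH; rewrite !mulrS -IH.
by rewrite natmulE -mulr_natr natz.
Qed.

Lemma div_of_point r (R : 'I_r -> place iota) (u : 'I_r -> nat) i :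
  injective R -> div_of R u (R i) = (u i)%:Z.
Proof.
move=> Rinj; rewrite div_ofE (bigD1 i) //= big1 => [|k ki].
  by rewrite asboolT // mul1n addr0.
by rewrite asboolF // => /Rinj E; rewrite E eqxx in ki.
Qed.

Lemma div_of_off r (R : 'I_r -> place iota) (u : 'I_r -> nat) v :
  (forall i, v <> R i) -> div_of R u v = 0.
Proof. by move=> vR; rewrite div_ofE big1 // => i _; rewrite asboolF. Qed.

(** If no function of [L(G)] reaches the full pole order [u j] at [R j], then [L(G)] and
    [L(G - R j)] are the same set, so no dimension has to be computed. *)
Lemma pure_gap_crit r (R : 'I_r -> place iota) (u : 'I_r -> nat) :
  injective R -> gaps R u -> (exists d, has_dim iota (RRspace (div_of R u)) d) ->
  (forall j (f : F), f != 0 -> (forall v : place iota, 0 <= v f + div_of R u v) ->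
     R j f <> - (u j)%:Z) ->
  pure_gap R u.
Proof.
move=> Rinj gap [d dimG] noext; split=> // j; exists d => //.
have subE v : (div_of R u - point_div (R j)) v = div_of R u v - (`[< v = R j >] : nat)%:Z.
  by [].
suff <- : RRspace (div_of R u) = RRspace (div_of R u - point_div (R j)) by [].
apply/seteqP; split=> f [->|Gf]; try by left.
  have [->|f0] := eqVneq f 0; [by left | right => v].
  have := Gf v; rewrite subE.
  have [vE|vE] := pselect (v = R j); last by rewrite asboolF // oppr0 addr0.
  rewrite asboolT // vE div_of_point //; have := noext j f f0 Gf.
  by move: (R j f) (u j) => A B; lia.
right=> v; have := Gf v; rewrite subE.
by move: (v f) (div_of R u v) (asbool _) => A B [] /=; lia.
Qed.

End FiniteDimension.

(** * The GK function field *)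

Section GKCurve.
Context (n : nat) (hn2 : (2 <= n)%N).
Context (hn : exists p k : nat, [/\ prime p, (0 < k)%N & n = (p ^ k)%N]).
Context (K : finFieldType) (hK : #|K| = (n ^ 6)%N).
Context (F : fieldType) (iota : {rmorphism K -> F}) (x y z : F).
Context (hF : GK_function_field n iota x y z).
Implicit Types (v : place iota) (f g r s : F).

Local Notation a := (n ^ 2 - n + 1)%N.
Local Notation b := (n ^ 3)%N.
Local Notation c := (n ^ 3 + 1)%N.

Lemma GK_pchar : exists2 p, p \in [pchar F] & p.-nat n.
Proof.
have [p [k [pr k0 nE]]] := hn; exists p; last by rewrite nE pnatX pnat_id.
rewrite (fmorph_pchar iota).
by rewrite (@card_finPcharP _ p (k * 6)) // hK nE expnM.
Qed.

Lemma GK_frobD k f g : (f + g) ^+ (n ^ k) = f ^+ (n ^ k) + g ^+ (n ^ k).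
Proof.
have [p pF pn] := GK_pchar; apply: exprDn_pchar.
by rewrite pnatX (eq_pnat _ (pcharf_eq pF)) pn.
Qed.

Lemma GK_frobN k f : (- f) ^+ (n ^ k) = - f ^+ (n ^ k).
Proof.
apply/eqP; rewrite -addr_eq0 -GK_frobD addNr expr0n expn_eq0.
by case: n hn2.
Qed.

Lemma iota_frob e : iota e ^+ (n ^ 6) = iota e.
Proof. by rewrite -hK -rmorphXn /= expf_card. Qed.

Lemma GK_x_neq e : x != iota e.
Proof.
apply/eqP => xE; apply: (GK_transcendental hF); exists ('X - e%:P).
  by rewrite polyXsubC_eq0.
by rewrite map_polyXsubC xE root_XsubC.
Qed.

Lemma GK_xnx_neq0 : x ^+ n + x != 0.
Proof.
apply/eqP => xE; apply: (GK_transcendental hF); exists ('X^n + 'X).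
  apply/eqP => /(congr1 (fun p : {poly K} => p`_1)).
  rewrite coefD coefXn coefX coef0 eqxx; case: eqP => [E|_]; first by move: hn2; rewrite -E.
  by move/eqP; rewrite add0r oner_eq0.
by rewrite rmorphD /= map_polyXn map_polyX rootE !hornerE xE.
Qed.

Lemma GK_y_neq0 : y != 0.
Proof.
by apply: contraNneq GK_xnx_neq0 => y0; rewrite (GK_eq_y hF) y0 expr0n.
Qed.

Lemma GK_h_telescope m s :
  (\sum_(i < m) (-1) ^+ i.+1 * s ^+ i) * (s + 1) = (-1) ^+ m * s ^+ m - 1.
Proof.
elim: m => [|m IH]; first by rewrite big_ord0 mul0r !expr0 mulr1 subrr.
by rewrite big_ord_recr /= mulrDl IH !exprS; ring.
Qed.

(** This trades [h(x)] for an additive polynomial in [y]. After multiplication by [x^n + x], the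
    alternating sum telescopes to [x^(n^2) - x], and [y^(n^2) = y (x^n + x)^(n-1)] lets Frobenius
    act on [(x^n + x)^n]. *)
Lemma GK_eq_yz : z ^+ a = y ^+ (n ^ 2) - y.
Proof.
have n1 : n = (n - 1).+1 by lia.
rewrite (GK_eq_z hF); apply: (mulIf GK_xnx_neq0).
have hE : GK_h n x * (x ^+ n + x) = x ^+ (n ^ 2) - x.
  pose s := x ^+ (n - 1).
  have -> : GK_h n x = \sum_(i < n.+1) (-1) ^+ i.+1 * s ^+ i.
    by apply: eq_bigr => i _; rewrite mulnC exprM.
  have -> : x ^+ n + x = (s + 1) * x by rewrite {1}n1 exprSr mulrDl mul1r.
  rewrite mulrA GK_h_telescope exprS; have := GK_frobN 1 1; rewrite expn1 expr1n => ->.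
  rewrite mulrNN !mul1r mulrBl mul1r -exprM -exprSr.
  by congr (_ ^+ _ - _); rewrite expnS expn1; nia.
have yE : y ^+ (n ^ 2) * (x ^+ n + x) = y * (x ^+ (n ^ 2) + x ^+ n).
  have -> : (n ^ 2 = (n.+1 * (n - 1)).+1)%N by rewrite expnS expn1; nia.
  rewrite exprS exprM -(GK_eq_y hF) -mulrA -exprSr -[(_ - _).+1]n1.
  have := GK_frobD 1 (x ^+ n) x; rewrite expn1 => ->; rewrite -exprM.
  by congr (_ * (_ ^+ _ + _)); nia.
by rewrite -mulrA hE mulrBl yE (GK_eq_y hF) -(GK_eq_y hF); ring.
Qed.

(** * The coordinate ring and its integrality over K[z] *)

Inductive coord : F -> Prop :=
| coord_iota e : coord (iota e)
| coord_x : coord x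
| coord_y : coord y
| coord_z : coord z
| coordD f g : coord f -> coord g -> coord (f + g)
| coordM f g : coord f -> coord g -> coord (f * g).

Definition zeval (q : {poly K}) : F := (map_poly iota q).[z].

HB.instance Definition _ :=
  GRing.RMorphism.copy zeval (horner_eval z \o map_poly iota).

Lemma coord0 : coord 0. Proof. by rewrite -(rmorph0 iota); exact: coord_iota. Qed.
Lemma coord1 : coord 1. Proof. by rewrite -(rmorph1 iota); exact: coord_iota. Qed.
#[local] Hint Resolve coord0 coord1 coord_iota coord_x coord_y coord_z : core.

Lemma coordN f : coord f -> coord (- f).
Proof. by move=> cf; rewrite -mulN1r -(rmorphN1 iota); exact: coordM. Qed.

Lemma coordB f g : coord f -> coord g -> coord (f - g).
Proof. by move=> cf cg; apply: coordD => //; exact: coordN. Qed.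

Lemma coordX f k : coord f -> coord (f ^+ k).
Proof. by move=> cf; elim: k => [//|k IH]; rewrite exprS; exact: coordM. Qed.

Lemma coord_sum (I : Type) (t : seq I) (P : pred I) (G : I -> F) :
  (forall i, P i -> coord (G i)) -> coord (\sum_(i <- t | P i) G i).
Proof. by move=> H; apply: big_ind => //; exact: coordD. Qed.

Lemma coord_prod (I : Type) (t : seq I) (P : pred I) (G : I -> F) :
  (forall i, P i -> coord (G i)) -> coord (\prod_(i <- t | P i) G i).
Proof. by move=> H; apply: big_ind => //; exact: coordM. Qed.

Lemma coord_zeval q : coord (zeval q).
Proof.
rewrite /zeval horner_coef; apply: coord_sum => i _.
by rewrite coef_map; apply: coordM; [exact: coord_iota | exact: coordX].
Qed.
#[local] Hint Resolve coord_zeval : core.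

(** [y] and [z] are integral over [K[x]], so [x] alone decides regularity. *)
Lemma coord_regular v f : 0 <= v x -> coord f -> 0 <= v f.
Proof.
move=> vx; have vy : 0 <= v y.
  have : 0 <= v (y ^+ n.+1) by rewrite -(GK_eq_y hF) regularD ?regularX.
  by rewrite ordX pmulrn_lge0.
have vz : 0 <= v z.
  have : 0 <= v (z ^+ a) by rewrite GK_eq_yz regularD ?ordN ?regularX.
  by rewrite ordX pmulrn_lge0 // addn1.
elim=> [e||||f1 f2 _ ? _ ?|f1 f2 _ ? _ ?] //; first by rewrite ord_iota.
- exact: regularD.
- exact: regularM.
Qed.

Lemma integral_trinomial (u e : F) m k : (1 < m)%N -> integralOver zeval e ->
  u ^+ m + (-1) ^+ k * u = e -> integralOver zeval u.
Proof.
move=> m1 ie uE.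
pose p : {poly F} := 'X^m + ((-1) ^+ k *: 'X - e%:P).
have sz : (size (((-1) ^+ k *: 'X - e%:P)%R : {poly F}) < m.+1)%N.
  apply: leq_ltn_trans (size_polyD _ _) _; rewrite gtn_max size_polyN.
  rewrite (leq_ltn_trans (size_scale_leq _ _)) ?size_polyX //.
  by rewrite (leq_ltn_trans (size_polyC_leq1 _)) //; lia.
apply: (@integral_root_monic _ _ _ _ p).
- by rewrite monicE lead_coefDl ?size_polyXn // lead_coefXn.
- by rewrite rootE !(hornerD, hornerN, hornerZ, hornerXn, hornerX, hornerC) addrA uE subrr.
apply/integral_poly => i; rewrite coefD coefXn coefB coefZ coefX coefC.
apply: integral_add; first exact: integral_nat.
apply: integral_sub; last by case: ifP => // _; exact: integral0.
apply: integral_mul; last exact: integral_nat.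
elim: k {uE p sz} => [|k IH]; first exact: integral1.
by rewrite exprS; apply: integral_mul => //; apply: integral_opp; exact: integral1.
Qed.

Lemma coord_integral f : coord f -> integralOver zeval f.
Proof.
have iz : integralOver zeval z.
  have -> : z = zeval 'X by rewrite /zeval map_polyX hornerX.
  exact: integral_id.
have iX u k : integralOver zeval u -> integralOver zeval (u ^+ k).
  move=> iu; elim: k => [|k IH]; first exact: integral1.
  by rewrite exprS; exact: integral_mul.
have iy : integralOver zeval y.
  apply: (@integral_trinomial _ (z ^+ a) (n ^ 2) 1); last 1 first.
  - by rewrite GK_eq_yz expr1 mulN1r.
  - by rewrite expnS expn1; nia.
  - exact: iX.
elim=> [e||||f1 f2 _ ? _ ?|f1 f2 _ ? _ ?] //.
- have -> : iota e = zeval e%:P by rewrite /zeval map_polyC hornerC.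
  exact: integral_id.
- apply: (@integral_trinomial _ (y ^+ n.+1) n 0) => //; first exact: iX.
  by rewrite expr0 mul1r (GK_eq_y hF).
- exact: integral_add.
- exact: integral_mul.
Qed.

(** Take a monic equation of [s] over [K[z]] and cancel powers of [s] until its constant term is
    nonzero: [s] divides that term. This plays the role of the norm to [K[z]]. *)
Lemma coord_divides s : coord s -> s != 0 ->
  exists r q, [/\ coord r, q != 0 & s * r = zeval q].
Proof.
move=> cs s0; have [p /monic_neq0] := coord_integral cs.
elim/poly_ind: p => [|p q IH]; first by rewrite eqxx.
have [->|q0 _] := eqVneq q 0.
  rewrite polyC0 addr0 mulf_eq0 polyX_eq0 orbF => /IH{}IH.
  rewrite rmorphM /= map_polyX rootE hornerMX mulf_eq0 (negPf s0) orbF.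
  exact: IH.
rewrite rootE rmorphD rmorphM /= map_polyX map_polyC hornerD hornerMX hornerC.
rewrite addr_eq0 => /eqP E; exists (map_poly zeval p).[s], (- q).
rewrite oppr_eq0; split=> //; last first.
  by rewrite mulrC; apply: etrans E _; exact: esym (rmorphN zeval q).
rewrite horner_coef; apply: coord_sum => i _; rewrite coef_map.
by apply: coordM; [exact: coord_zeval | exact: coordX].
Qed.

(** * Orders at infinity and denominators in K[z] *)

Context (Pinf : place iota) (Pinf_x : Pinf x < 0).

(** Dominant terms of the two equations give [(n + 1) v(y) = n v(x)] and [a v(z) = n^2 v(y)];
    coprimality fixes the orders up to a common factor [k], shown to be 1 in [GK_ord_inf1]. *)
Lemma GK_ord_inf v : v x < 0 -> exists2 k : nat, (0 < k)%N &
  [/\ v x = - (c * k)%:Z, v y = - (a * n * k)%:Z & v z = - (b * k)%:Z].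
Proof.
move=> vx; have n0 : (0 < n)%N by lia.
have x0 : x != 0 by rewrite -(rmorph0 iota) GK_x_neq.
have y0 := GK_y_neq0.
have [_] : x ^+ n + x != 0 /\ v (x ^+ n + x) = v (x ^+ n).
  apply: ordD_lt; rewrite ?expf_neq0 // ordXz => _.
  by rewrite -subr_gt0 -{1}[v x]mulr1 -mulrBr nmulr_rgt0 //; lia.
rewrite (GK_eq_y hF) !ordXz => yE.
have vy : v y < 0.
  have : v x * n%:Z < 0 by rewrite pmulr_llt0.
  by rewrite -yE pmulr_llt0.
have [_] : y ^+ (n ^ 2) - y != 0 /\ v (y ^+ (n ^ 2) - y) = v (y ^+ (n ^ 2)).
  apply: ordD_lt; rewrite ?expf_neq0 // ordN ordXz => _.
  have : (1 < n ^ 2)%N by rewrite expnS expn1; nia.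
  by rewrite -subr_gt0 -{1}[v y]mulr1 -mulrBr nmulr_rgt0 //; lia.
rewrite -GK_eq_yz !ordXz => zE.
have a0 : (0 < a)%N by lia.
have vz : v z < 0.
  have : v y * (n ^ 2)%N%:Z < 0 by rewrite pmulr_llt0 // ltz_nat expn_gt0 n0.
  by rewrite -zE pmulr_llt0 // ltz_nat.
have [X xE] : exists X : nat, v x = - X%:Z by exists `|v x|%N; lia.
have [Y yE'] : exists Y : nat, v y = - Y%:Z by exists `|v y|%N; lia.
have [Z zE'] : exists Z : nat, v z = - Z%:Z by exists `|v z|%N; lia.
have {}yE : (Y * n.+1 = X * n)%N by rewrite xE yE' in yE; lia.
have {}zE : (Z * a = Y * n ^ 2)%N.
  by move: zE; rewrite yE' zE' !mulNr => /oppr_inj; rewrite -!PoszM => -[].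
have /dvdnP[X1 X1E] : (n.+1 %| X)%N.
  by rewrite -(@Gauss_dvdl _ _ n) ?coprimeSn // -yE dvdn_mull.
have YE : Y = (X1 * n)%N.
  by apply/eqP; rewrite -(@eqn_pmul2r n.+1) // yE X1E; apply/eqP; ring.
have /dvdnP[k kE] : (a %| X1)%N.
  rewrite -(@Gauss_dvdl _ _ b) ?coprimeXr ?coprime_GKexp //.
  suff -> : (X1 * b = Z * a)%N by rewrite dvdn_mull.
  by rewrite zE YE; ring.
have ZE : (Z = b * k)%N.
  by apply/eqP; rewrite -(@eqn_pmul2r a) // zE YE kE; apply/eqP; ring.
have k0 : (0 < k)%N by case: k kE ZE => // _; lia.
exists k => //; split.
- by rewrite xE X1E kE -GKexp_mul //; congr (- Posz _); ring.
- by rewrite yE' YE kE; congr (- Posz _); ring.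
- by rewrite zE' ZE.
Qed.

Lemma zeval_neq0 q : q != 0 -> zeval q != 0.
Proof.
have [k k0 [_ _ vz]] := GK_ord_inf Pinf_x.
have z_lt0 : Pinf z < 0.
  by rewrite vz oppr_lt0 ltz_nat muln_gt0 k0 expn_gt0 andbT; lia.
by case/(ord_horner z_lt0).
Qed.

(** The functions with a denominator in [K[z]] form a subfield containing the generators; inverses
    come from [coord_divides]. *)
Lemma GK_fraction f : exists2 q, q != 0 & coord (zeval q * f).
Proof.
pose S : {pred F} := fun f => `[< exists2 q, q != 0 & coord (zeval q * f) >].
suff /asboolP : f \in S by [].
have coordS g : coord g -> g \in S.
  by move=> cg; apply/asboolP; exists 1; rewrite ?oner_eq0 // rmorph1 mul1r.
apply: (GK_generated hF); try by move=> *; apply: coordS.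
split; first exact: coordS.
- move=> f1 f2 /asboolP[q1 q10 c1] /asboolP[q2 q20 c2]; apply/asboolP.
  exists (q1 * q2); first by rewrite mulf_neq0.
  rewrite rmorphM mulrBr; apply: coordB; last by rewrite -mulrA; exact: coordM.
  by rewrite mulrAC; exact: coordM.
move=> f1 f2 /asboolP[q1 q10 c1] /asboolP[q2 q20 c2]; apply/asboolP.
have [->|f20] := eqVneq f2 0.
  by exists 1; rewrite ?oner_eq0 // invr0 !mulr0.
have [|r [q [cr q0 rE]]] := coord_divides c2.
  by rewrite mulf_neq0 ?zeval_neq0.
exists (q1 * q); first by rewrite mulf_neq0.
have -> : zeval (q1 * q) * (f1 / f2) = zeval q1 * f1 * (zeval q2 * r).
  by rewrite rmorphM /= -rE; field.
by apply: coordM => //; exact: coordM.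
Qed.

(** * Normal form over K[z] and weights *)

Local Notation idx := ('I_n * 'I_(n ^ 2))%type.
Local Notation weight l be ga := (l * c + be * (a * n) + ga * b)%N.

Definition nform (C : idx -> {poly K}) : F :=
  \sum_(i : idx) zeval (C i) * (y ^+ i.2 * x ^+ i.1).

Definition nspan f := exists C, f = nform C.

Lemma nspanD f g : nspan f -> nspan g -> nspan (f + g).
Proof.
move=> [C ->] [D ->]; exists (fun i => C i + D i).
by rewrite -big_split; apply: eq_bigr => i _; rewrite rmorphD mulrDl.
Qed.

Lemma nspan_scale q f : nspan f -> nspan (zeval q * f).
Proof.
move=> [C ->]; exists (fun i => q * C i); rewrite mulr_sumr.
by apply: eq_bigr => i _; rewrite rmorphM mulrA.
Qed.

Lemma nspanN f : nspan f -> nspan (- f).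
Proof.
by move=> /(nspan_scale (-1)); rewrite rmorphN rmorph1 mulN1r.
Qed.

Lemma nspan0 : nspan 0.
Proof.
by exists (fun=> 0); rewrite /nform big1 // => i _; rewrite rmorph0 mul0r.
Qed.

Lemma nspan_mono i j : (i < n)%N -> (j < n ^ 2)%N -> nspan (y ^+ j * x ^+ i).
Proof.
move=> i_n jn; pose o : idx := (Ordinal i_n, Ordinal jn).
exists (fun k => (k == o)%:R); rewrite /nform (bigD1 o) //= big1 => [|k /negPf ->].
  by rewrite eqxx rmorph1 mul1r addr0.
by rewrite rmorph0 mul0r.
Qed.

Lemma nspan_mul h f :
  (forall i j, (i < n)%N -> (j < n ^ 2)%N -> nspan (h * (y ^+ j * x ^+ i))) ->
  nspan f -> nspan (h * f).
Proof.
move=> H [C ->]; rewrite mulr_sumr.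
apply: big_ind; [exact: nspan0 | exact: nspanD |] => i _.
by rewrite mulrCA; apply: nspan_scale; apply: H.
Qed.

Lemma zevalX : zeval 'X = z.
Proof. by rewrite /zeval map_polyX hornerX. Qed.

Lemma zevalC e : zeval e%:P = iota e.
Proof. by rewrite /zeval map_polyC hornerC. Qed.

Lemma nspan_muly f : nspan f -> nspan (y * f).
Proof.
apply: nspan_mul => i j i_n; rewrite mulrA -exprS leq_eqVlt => /orP[/eqP E|].
  have n2 : (1 < n ^ 2)%N by rewrite expnS expn1; nia.
  have -> : y ^+ j.+1 = y ^+ 1 + z ^+ a by rewrite E GK_eq_yz; ring.
  rewrite mulrDl; apply: nspanD; first exact: nspan_mono.
  rewrite -zevalX -rmorphXn; apply: nspan_scale.
  by rewrite -[x ^+ i]mul1r -(expr0 y); apply: nspan_mono; lia.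
exact: nspan_mono.
Qed.

Lemma nspan_mulx f : nspan f -> nspan (x * f).
Proof.
apply: nspan_mul => i j i_n jn; rewrite mulrCA -exprS.
move: i_n; rewrite leq_eqVlt => /orP[/eqP E|]; last by move=> ?; exact: nspan_mono.
have -> : y ^+ j * x ^+ i.+1 = y ^+ n.+1 * (y ^+ j * x ^+ 0) - y ^+ j * x ^+ 1.
  by rewrite E -(GK_eq_y hF); ring.
apply: nspanD; last by apply/nspanN/nspan_mono.
elim: n.+1 => [|k IH]; first by rewrite mul1r; apply: nspan_mono; lia.
by rewrite exprS -mulrA; exact: nspan_muly.
Qed.

(** The induction shows that multiplication by [f] preserves [nspan]: in this form the case of a
    product is mere composition. *)
Lemma coord_nform f : coord f -> nspan f.
Proof.
move=> cf; suff /(_ 1) : forall g, nspan g -> nspan (f * g).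
  rewrite mulr1; apply; rewrite -[1]mul1r -{1}(expr0 y) -(expr0 x).
  by apply: nspan_mono; rewrite ?expn_gt0; lia.
elim: cf => [e||||f1 f2 _ IH1 _ IH2|f1 f2 _ IH1 _ IH2] g sg.
- by rewrite -zevalC; exact: nspan_scale.
- exact: nspan_mulx.
- exact: nspan_muly.
- by rewrite -zevalX; exact: nspan_scale.
- by rewrite mulrDl; apply: nspanD; [exact: IH1 | exact: IH2].
- by rewrite -mulrA; apply: IH1; exact: IH2.
Qed.

Definition nform_wt (C : idx -> {poly K}) (i : idx) : nat :=
  weight i.1 i.2 (size (C i)).-1.

(** The terms have distinct orders, so the heaviest one dominates. The index [i] is chosen from the
    weights alone, before [v], so one weight serves all places at infinity. *)
Lemma nform_weight C : nform C != 0 ->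
  exists i, [/\ C i != 0, forall j, C j != 0 -> (nform_wt C j <= nform_wt C i)%N
    & forall v k, (0 < k)%N ->
        v x = - (c * k)%:Z -> v y = - (a * n * k)%:Z -> v z = - (b * k)%:Z ->
        v (nform C) = - (nform_wt C i * k)%:Z].
Proof.
move=> r0; have n0 : (0 < n)%N by lia.
have [i0 Ci0] : exists i, C i != 0.
  apply: contrapT => C0; case/negP: r0; rewrite /nform big1 ?eqxx // => i _.
  have [->|Ci] := eqVneq (C i) 0; first by rewrite rmorph0 mul0r.
  by case: C0; exists i.
case: (@arg_maxnP _ i0 (fun i => C i != 0) (nform_wt C) Ci0) => i Ci Wmax.
exists i; split=> // v k k0 vx vy vz.
pose G (j : idx) := zeval (C j) * (y ^+ j.2 * x ^+ j.1).
have x0 : x != 0 by rewrite -(rmorph0 iota) GK_x_neq.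
have y0 := GK_y_neq0.
have vG j : C j != 0 -> G j != 0 /\ v (G j) = - (nform_wt C j * k)%:Z.
  move=> Cj; have vz0 : v z < 0 by rewrite vz oppr_lt0 ltz_nat muln_gt0 k0 expn_gt0 n0.
  have [q0 vq] := ord_horner vz0 Cj.
  have m0 : y ^+ j.2 * x ^+ j.1 != 0 by rewrite mulf_neq0 ?expf_neq0.
  split; first by rewrite mulf_neq0.
  rewrite /G !ordM ?expf_neq0 // vq !ordXz vx vy vz -mulr_natr natz /nform_wt.
  by rewrite !mulNr -!opprD -!PoszM -!PoszD; congr (- Posz _); ring.
have Gn0 j : G j != 0 -> C j != 0.
  by apply: contraNneq; rewrite /G => ->; rewrite rmorph0 mul0r.
case: (@ord_sum_distinct _ _ _ v _ G).
- move=> j1 j2 /Gn0/vG[_ ->] /Gn0/vG[_ ->] /oppr_inj[] /eqP.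
  rewrite eqn_pmul2r // => /eqP E.
  have [] := @GK_weight_inj n (size (C j1)).-1 j1.2 j1.1 (size (C j2)).-1 j2.2 j2.1 hn2.
  - exact: ltn_ord.
  - exact: ltn_ord.
  - exact: ltn_ord.
  - exact: ltn_ord.
  - have wE l be ga : (ga * b + be * (a * n) + l * c = weight l be ga)%N by ring.
    by rewrite !wE.
  by case: j1 j2 {E} => [? ?] [? ?] /= /val_inj -> /val_inj ->.
- by exists i0; have [] := vG _ Ci0.
move=> j [/Gn0 Cj _ vS jmin]; rewrite /nform vS; have [_ ->] := vG j Cj.
have [Gi vGi] := vG i Ci.
have := jmin _ Gi; rewrite vGi; have [_ ->] := vG j Cj.
rewrite lerN2 lez_nat leq_pmul2r // => le_ij.
by congr (- Posz (_ * k)); apply/eqP; rewrite eqn_leq le_ij andbT; exact: Wmax.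
Qed.

Lemma coord_weight r : coord r -> r != 0 ->
  exists l be ga, forall v k, (0 < k)%N ->
    v x = - (c * k)%:Z -> v y = - (a * n * k)%:Z -> v z = - (b * k)%:Z ->
    v r = - (weight l be ga * k)%:Z.
Proof.
move=> /coord_nform[C ->] /nform_weight[i [_ _ vC]].
by exists i.1, i.2, (size (C i)).-1.
Qed.

(** All elements of the coordinate ring have order divisible by [k] at [v], hence so do their
    quotients; but [v] is normalized and takes the value 1. *)
Lemma GK_ord_inf1 v : v x < 0 ->
  [/\ v x = - c%:Z, v y = - (a * n)%:Z & v z = - b%:Z].
Proof.
move=> vx; have [k k0 [xE yE zE]] := GK_ord_inf vx.
suff k1 : k = 1%N by rewrite k1 !muln1 in xE yE zE.
have div r : coord r -> r != 0 -> exists d : int, v r = d * k%:Z.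
  move=> cr r0; have [l [be [ga H]]] := coord_weight cr r0.
  by exists (- (weight l be ga)%:Z); rewrite (H v k) // PoszM mulNr.
have [t t0 vt] := ord_normalized v.
have [q q0 cqt] := GK_fraction t.
have zq0 := zeval_neq0 q0.
have [d1 vq] := div _ (coord_zeval q) zq0.
have [d2] := div _ cqt (mulf_neq0 zq0 t0).
rewrite ordM // vt vq => E.
have {}E : (d2 - d1) * k%:Z = 1 by rewrite mulrBl -E; ring.
have : (`|(d2 - d1)%R| * k)%N = 1%N by rewrite -[k]/(`|k%:Z|%N) -abszM E.
by move/eqP; rewrite muln_eq1 => /andP[_ /eqP].
Qed.

Lemma coord_weight1 r : coord r -> r != 0 ->
  exists l be ga, forall v, v x < 0 -> v r = - (weight l be ga)%:Z.
Proof.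
move=> cr r0; have [l [be [ga H]]] := coord_weight cr r0.
exists l, be, ga => v /GK_ord_inf1[xE yE zE].
by rewrite (H v 1%N) ?muln1.
Qed.

(** Orders of elements of the coordinate ring at a pole of [x] are determined by their weights, and
    [GK_fraction] extends this to all functions. *)
Lemma GK_inf_unique v : v x < 0 -> v = Pinf.
Proof.
move=> vx; apply: place_eq => f f0.
have [q q0 cqf] := GK_fraction f.
have zq0 := zeval_neq0 q0.
have [l1 [b1 [g1 H1]]] := coord_weight1 (coord_zeval q) zq0.
have [l2 [b2 [g2 H2]]] := coord_weight1 cqf (mulf_neq0 zq0 f0).
apply: (addrI (v (zeval q))).
by rewrite -ordM // H1 // -(H1 _ Pinf_x) -ordM // !H2.
Qed.

(** * Primes of the coordinate ring and places *)

Definition zdiv (p : {poly K}) f := exists2 r, coord r & f = zeval p * r.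

Lemma zdivD p f g : zdiv p f -> zdiv p g -> zdiv p (f + g).
Proof.
by move=> [r cr ->] [s cs ->]; exists (r + s); [exact: coordD | rewrite mulrDr].
Qed.

Lemma zdivM p f g : zdiv p f -> coord g -> zdiv p (f * g).
Proof.
by move=> [r cr ->] cg; exists (r * g); [exact: coordM | rewrite mulrA].
Qed.

Lemma zdivX p f k : zdiv p f -> (0 < k)%N -> zdiv p (f ^+ k).
Proof.
case: k => // k zf _; rewrite exprS; apply: zdivM => //; apply: coordX.
by case: zf => r cr ->; exact: coordM.
Qed.

Lemma zdiv0 p : zdiv p 0.
Proof. by exists 0; rewrite ?mulr0. Qed.

Definition zfrob p k f := coord f /\ zdiv p (f ^+ (n ^ k) - f).

Lemma zfrobD p k f g : zfrob p k f -> zfrob p k g -> zfrob p k (f + g).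
Proof.
move=> [cf zf] [cg zg]; split; first exact: coordD.
by rewrite GK_frobD opprD addrACA; exact: zdivD.
Qed.

Lemma zfrobM p k f g : zfrob p k f -> zfrob p k g -> zfrob p k (f * g).
Proof.
move=> [cf zf] [cg zg]; split; first exact: coordM.
have -> : (f * g) ^+ (n ^ k) - f * g =
    (g ^+ (n ^ k) - g) * f ^+ (n ^ k) + (f ^+ (n ^ k) - f) * g.
  by rewrite exprMn; ring.
by apply: zdivD; apply: zdivM => //; exact: coordX.
Qed.

Lemma zfrob_iota p k e : zfrob p (6 * k) (iota e).
Proof.
split=> //; suff -> : iota e ^+ (n ^ (6 * k)) = iota e by rewrite subrr; exact: zdiv0.
elim: k => [|k IH]; first by rewrite muln0 expr1.
by rewrite mulnSr expnD exprM IH iota_frob.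
Qed.

Lemma zfrob1 p k : zfrob p k 1.
Proof. by split=> //; rewrite expr1n subrr; exact: zdiv0. Qed.

Lemma zfrob0 p k : zfrob p k 0.
Proof.
split=> //; rewrite expr0n expn_eq0 subr0.
by case: eqP hn2 => [->|_ _]; last exact: zdiv0.
Qed.

Lemma zfrobX p k f l : zfrob p k f -> zfrob p k (f ^+ l).
Proof.
by move=> zf; elim: l => [|l IH]; [exact: zfrob1 | rewrite exprS; exact: zfrobM].
Qed.

Lemma zfrobN p k f : zfrob p k f -> zfrob p k (- f).
Proof.
move=> [cf zf]; split; first exact: coordN.
rewrite GK_frobN -opprD -mulN1r mulrC; apply: zdivM => //.
exact: coordN.
Qed.

Lemma zfrob_mul p k l f : zfrob p k f -> zfrob p (k * l) f.
Proof.
move=> [cf zf]; split=> //; elim: l => [|l IH].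
  by rewrite muln0 expr1 subrr; exact: zdiv0.
have -> : f ^+ (n ^ (k * l.+1)) - f =
    (f ^+ (n ^ (k * l)) - f) ^+ (n ^ k) + (f ^+ (n ^ k) - f).
  by rewrite GK_frobD GK_frobN -exprM -expnD -mulnSr; ring.
by apply: zdivD => //; apply: zdivX => //; rewrite expn_gt0; lia.
Qed.

(* If Frobenius shifts t by a fixed element, its iterates shift t by multiples
   of a fixed element, so t itself is fixed after char F further iterations. *)
Lemma zfrob_additive p e l ch w t : ch \in [pchar F] -> coord t ->
  t ^+ (n ^ e) = t + w -> zfrob p (e * l) w -> zfrob p (e * l * ch) t.
Proof.
move=> chF ct tE zw.
have [W zW tW] : exists2 W, zfrob p (e * l) W & t ^+ (n ^ (e * l)) = t + W.
  suff H i : exists2 W, zfrob p (e * l) W & t ^+ (n ^ (e * i)) = t + W by exact: H.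
  elim: i => [|i [W zW tW]].
    by exists 0; [exact: zfrob0 | rewrite muln0 expr1 addr0].
  exists (w + W ^+ (n ^ e)); first by apply: zfrobD => //; exact: zfrobX.
  by rewrite mulnSr expnD exprM tW GK_frobD tE addrA.
split=> //; have -> : t = t + W *+ ch by rewrite mulrn_pchar // addr0.
rewrite {1}mulrn_pchar // addr0.
elim: (ch) => [|i IH]; first by rewrite muln0 expr1 addr0 subrr; exact: zdiv0.
have zWi : zfrob p (e * l) (W *+ i).
  elim: i {IH} => [|i IH]; last by rewrite mulrS; exact: zfrobD.
  exact: zfrob0.
have -> : t ^+ (n ^ (e * l * i.+1)) - (t + W *+ i.+1) =
    (t ^+ (n ^ (e * l * i)) - (t + W *+ i)) ^+ (n ^ (e * l)) +
    ((W *+ i) ^+ (n ^ (e * l)) - W *+ i).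
  by rewrite GK_frobD GK_frobN GK_frobD tW -exprM -expnD -mulnSr mulrS; ring.
by apply: zdivD; [apply: zdivX; rewrite // expn_gt0; lia | case: zWi].
Qed.

(** Elements fixed modulo [p] by a power of Frobenius are stable under sums and products, so [K],
    [x], [y], [z] suffice. With [d] the degree of [p], [z] is fixed by the [#|K|^d]-th power;
    passing to [y] and then to [x] costs a factor [ch] in the exponent each time. *)
Lemma zdiv_power p : irreducible_poly p ->
  exists2 N, (1 < N)%N & forall f, coord f -> zdiv p (f ^+ N - f).
Proof.
move=> irr; have [ch chF _] := GK_pchar.
have ch0 : (0 < ch)%N by case/andP: chF => /prime_gt0.
pose d := (size p).-1; have d0 : (0 < d)%N by case: irr; rewrite /d; lia.
(* [n^(6d) = #|K|^d]; the factor 2 is split off because [zfrob_additive] is applied with [e = 2]. *)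
have zz : zfrob p (2 * (3 * d)) z.
  split=> //; have /dvdpP[q qE] := irreducible_dvdp_XcardX irr.
  have -> : z ^+ (n ^ (2 * (3 * d))) - z = zeval ('X^(#|K| ^ (size p).-1) - 'X).
    by rewrite rmorphB rmorphXn /= zevalX hK -expnM mulnA.
  by rewrite qE rmorphM mulrC; exists (zeval q).
have zy : zfrob p (2 * (3 * d) * ch) y.
  apply: (@zfrob_additive _ _ _ _ (z ^+ a)) => //; last exact: zfrobX.
  by rewrite GK_eq_yz; ring.
have zx : zfrob p (2 * (3 * d) * ch * ch) x.
  rewrite -(mulnA 2).
  (* Using [x^n = y^(n+1) - x] twice restores the sign of [x], so the [n^2]-th power is a shift. *)
  apply: (@zfrob_additive _ _ _ _ (y ^+ (n.+1 * n) - y ^+ n.+1)) => //.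
    have xn : x ^+ n = y ^+ n.+1 - x by rewrite -(GK_eq_y hF); ring.
    rewrite expnS expn1 exprM xn.
    have := GK_frobD 1 (y ^+ n.+1) (- x); have := GK_frobN 1 x; rewrite expn1.
    by move=> -> ->; rewrite xn exprM; ring.
  by rewrite mulnA; apply: zfrobD; [|apply: zfrobN]; exact: zfrobX.
have nk : (1 < n ^ (2 * (3 * d) * ch * ch))%N.
  by rewrite -{1}(expn0 n) ltn_exp2l // !muln_gt0 d0 ch0.
exists (n ^ (2 * (3 * d) * ch * ch))%N => // f cf.
suff [] : zfrob p (2 * (3 * d) * ch * ch) f by [].
elim: cf => [e||||f1 f2 _ ? _ ?|f1 f2 _ ? _ ?].
- have -> : (2 * (3 * d) * ch * ch = 6 * (d * ch * ch))%N by ring.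
  exact: zfrob_iota.
- exact: zx.
- exact: zfrob_mul.
- by rewrite -mulnA; exact: zfrob_mul.
- exact: zfrobD.
- exact: zfrobM.
Qed.

(** * Existence of prime ideals *)

Definition coord_ideal (J : set F) :=
  [/\ (forall f, J f -> coord f), J 0, forall f g, J f -> J g -> J (f + g)
    & forall f g, J f -> coord g -> J (f * g)].

Definition prime_ideal (J : set F) :=
  [/\ coord_ideal J, ~ J 1
    & forall f g, coord f -> coord g -> J (f * g) -> J f \/ J g].

Lemma prime_ideal_exists (J : set F) : coord_ideal J -> ~ J 1 ->
  exists2 M, prime_ideal M & forall f, J f -> M f.
Proof.
move=> idJ J1; have [Jc J0 JD JM] := idJ.
(* The condition is put on the union of [J] and [A] so that the empty chain, whose union is empty,
   also satisfies it. *)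
pose P (A : set F) := coord_ideal (J `|` A)%classic /\ ~ (J `|` A)%classic 1.
have [|A [[idA A1] Amax]] := @Zorn_bigcup F P.
  move=> C CP tot.
  have common f g : (J `|` \bigcup_(X in C) X)%classic f ->
      (J `|` \bigcup_(X in C) X)%classic g ->
      (J f /\ J g) \/ exists2 X, C X & (J `|` X)%classic f /\ (J `|` X)%classic g.
    move=> [Jf|[X CX Xf]] [Jg|[Y CY Yg]]; first by left.
    - by right; exists Y => //; split; [left | right].
    - by right; exists X => //; split; [right | left].
    - right; have [XY|YX] := tot X Y CX CY.
        by exists Y => //; split; right => //; exact: XY.
      by exists X => //; split; right => //; exact: YX.
  have up X f : C X -> (J `|` X)%classic f -> (J `|` \bigcup_(X in C) X)%classic f.
    by move=> CX [Jf|Xf]; [left | right; exists X].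
  split; last first.
    move=> O; have [[//]|[X CX [X1 _]]] := common _ _ O O.
    by have [_] := CP _ CX; apply.
  split.
  - move=> f Of; have [[/Jc//]|[X CX [Xf _]]] := common _ _ Of Of.
    by have [[Xc _ _ _] _] := CP _ CX; exact: Xc.
  - by left.
  - move=> f g Of Og; have [[Jf Jg]|[X CX [Xf Xg]]] := common _ _ Of Og.
      by left; exact: JD.
    by have [[_ _ XD _] _] := CP _ CX; apply: (up _ _ CX); exact: XD.
  - move=> f g Of cg; have [[Jf _]|[X CX [Xf _]]] := common _ _ Of Of.
      by left; exact: JM.
    by have [[_ _ _ XM] _] := CP _ CX; apply: (up _ _ CX); exact: XM.
exists (J `|` A)%classic; last by left.
set M := (J `|` A)%classic in idA A1 *.
have [Mc M0 MD MM] := idA.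
split=> // f g cf cg Mfg; apply: contrapT => /not_orP[nf ng]; apply: ng.
(* [I] is the ideal generated by [M] and [f]. By maximality it contains 1, and multiplying
   [1 = u + r f] by [g] puts [g] in [M]. *)
pose I : set F := fun h => exists u r, [/\ M u, coord r & h = u + r * f].
have MI h : M h -> I h by move=> Mh; exists h, 0; rewrite mul0r addr0.
have JI : (J `|` I)%classic = I.
  by apply/seteqP; split=> h; [move=> [Jh|//]; apply: MI; left | right].
have [u [r [Mu cr E]]] : I 1.
  apply: contrapT => I1; apply: (Amax I).
    split; first by move=> h Ah; apply: MI; right.
    move=> /(_ f) If; apply: nf; right; apply: If.
    by exists 0, 1; rewrite add0r mul1r.
  rewrite /P JI; split=> //; split.
  - move=> h [u [r [/Mc cu cr ->]]]; apply: coordD => //; exact: coordM.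
  - exact: MI.
  - move=> h1 h2 [u1 [r1 [M1 c1 ->]]] [u2 [r2 [M2 c2 ->]]].
    exists (u1 + u2), (r1 + r2); split; [exact: MD | exact: coordD | ring].
  - move=> h1 h2 [u1 [r1 [M1 c1 ->]]] c2; exists (u1 * h2), (r1 * h2).
    by split; [exact: MM | exact: coordM | ring].
rewrite -[g]mul1r E mulrDl; apply: MD; first exact: MM.
by rewrite -mulrA mulrC; exact: MM.
Qed.

(** * The discrete valuation at a prime containing p(z) *)

Section LocalRing.
Context (p : {poly K}) (irr : irreducible_poly p).
Context (M : set F) (primeM : prime_ideal M) (Mp : M (zeval p)).

Let Mc f : M f -> coord f.
Proof. by case: primeM => -[+ _ _ _] _ _; apply. Qed.
Let MD f g : M f -> M g -> M (f + g).
Proof. by case: primeM => -[_ _ + _] _ _; apply. Qed.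
Let MM f g : M f -> coord g -> M (f * g).
Proof. by case: primeM => -[_ _ _ +] _ _; apply. Qed.
Let M1 : ~ M 1. Proof. by case: primeM. Qed.
Let M0 : M 0. Proof. by case: primeM => -[_ + _ _]. Qed.
Let p0 : zeval p != 0. Proof. exact/zeval_neq0/irredp_neq0. Qed.

Lemma notM_mul f g : coord f -> coord g -> ~ M f -> ~ M g -> ~ M (f * g).
Proof. by move=> cf cg nf ng; case: primeM => _ _ H /(H _ _ cf cg)[]. Qed.

(* zeval p is a local parameter: this is where F / K(z) being unramified at
   finite places enters. *)
Lemma ideal_local g : M g -> exists s, [/\ coord s, ~ M s & zdiv p (s * g)].
Proof.
move=> Mg; have cg := Mc Mg; have [N N1 /(_ g cg) zg] := zdiv_power irr.
exists (g ^+ N.-1 - 1).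
have cs : coord (g ^+ N.-1 - 1) by apply: coordB => //; exact: coordX.
split=> //; last by rewrite mulrBl -exprSr mul1r prednK //; lia.
move=> Ms; apply: M1; rewrite -(subKr (g ^+ N.-1) 1); apply: MD.
  have -> : N.-1 = N.-2.+1 by lia.
  by rewrite exprS; apply: MM => //; exact: coordX.
by rewrite -mulrN1; apply: MM => //; rewrite -(rmorphN1 iota).
Qed.

Definition local_val f (k : int) := exists s h,
  [/\ coord s, coord h, ~ M s, ~ M h & s * f = zeval p ^ k * h].

Lemma local_val_uniq f k l : local_val f k -> local_val f l -> k = l.
Proof.
wlog lt : k l / k < l => [H|].
  by move=> vk vl; case: (ltgtP k l) => // ?; [| symmetry]; exact: H.
move=> [s [h [cs ch ns nh E]]] [s' [h' [cs' ch' ns' nh' E']]].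
have [j lE] : exists j : nat, l = k + j.+1%:Z by exists (`|l - k|.-1)%N; lia.
have : s' * h = zeval p * (zeval p ^+ j * (s * h')).
  apply: (@mulfI _ (zeval p ^ k)); first by rewrite expfz_neq0.
  rewrite mulrCA -E mulrCA E' lE expfzDr // -exprnP exprS; ring.
move=> E2; have [] := notM_mul cs' ch ns' nh; rewrite E2; apply: MM => //.
by apply: coordM; [exact: coordX | exact: coordM].
Qed.

Lemma local_valM f g k l :
  local_val f k -> local_val g l -> local_val (f * g) (k + l).
Proof.
move=> [s [h [cs ch ns nh E]]] [s' [h' [cs' ch' ns' nh' E']]].
exists (s * s'), (h * h'); split; try exact: coordM; try exact: notM_mul.
by rewrite mulrACA E E' expfzDr //; ring.
Qed.

Lemma local_val_coord f k : coord f -> local_val f k -> 0 <= k.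
Proof.
move=> cf [s [h [cs ch ns nh E]]]; rewrite leNgt; apply/negP => k0; apply: nh.
have [j kE] : exists j : nat, k = - j.+1%:Z by exists (`|k|.-1)%N; lia.
have -> : h = zeval p * (zeval p ^+ j * (s * f)).
  apply: (@mulfI _ (zeval p ^ k)); first by rewrite expfz_neq0.
  rewrite -E [zeval p * (_ * _)]mulrA -exprS [RHS]mulrA kE -exprnN.
  by rewrite mulVf ?mul1r // expf_neq0.
by apply: MM => //; apply: coordM; [exact: coordX | exact: coordM].
Qed.

Lemma local_val_off f : coord f -> ~ M f -> local_val f 0.
Proof. by move=> cf nf; exists 1, f; split=> //; rewrite expr0z. Qed.

(** Some multiple [g r] equals [q(z) u] with [u] outside [M], and the degree of [q] bounds how often
    [p] can be extracted. If [g] is in [M], then [p] divides [q], since otherwise a Bezout relation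
    keeps [q(z)] outside [M]; cancelling [p] lowers the degree. *)
Lemma local_val_exists_coord g : coord g -> g != 0 -> exists k, local_val g k.
Proof.
move=> cg g0; have [r [q [cr q0 E]]] := coord_divides cg g0.
suff: forall N (q : {poly K}) g r u, (size q < N)%N -> q != 0 -> coord g -> g != 0 -> coord r ->
    coord u -> ~ M u -> g * r = zeval q * u -> exists k, local_val g k.
  by move/(_ _ q g r 1 (ltnSn _)); apply; rewrite ?mulr1.
elim=> // N IH {}q {}g {}r u sq {}q0 {}cg {}g0 {}cr cu nu {}E.
have [Mg|ng] := pselect (M g); last by exists 0; exact: local_val_off.
have [s [cs ns [g1 cg1 gE]]] := ideal_local Mg.
have s0 : s != 0 by apply: contra_not_neq ns => ->.
have [/dvdpP[q1 qE]|npq] := boolP (p %| q); last first.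
  have [[w1 w2] /= wE] : exists w, w.1 * p + w.2 * q = 1.
    by apply/Bezout_eq1_coprimepP; rewrite irreducible_poly_coprime.
  have nq : ~ M (zeval q).
    move=> Mq; apply: M1; rewrite -(rmorph1 zeval) -wE rmorphD !rmorphM /=.
    by apply: MD; rewrite mulrC; apply: MM.
  by have [] := notM_mul (coord_zeval q) cu nq nu; rewrite -E; exact: MM.
have [q10 _] : q1 != 0 /\ p != 0 by apply/norP; rewrite -mulf_eq0 -qE.
have g10 : g1 != 0.
  by have := mulf_neq0 s0 g0; rewrite gE mulf_eq0 negb_or => /andP[].
have [||||||||k [t [h [ct ch nt nh tE]]]] := IH q1 g1 r (s * u).
- have := irr.1; move: sq; rewrite qE size_mul ?(irredp_neq0 irr) //.
  by move: (size q1) (size p) => [|i] [|[|j]] //=; rewrite ?addnS /=; lia.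
- exact: q10.
- exact: cg1.
- exact: g10.
- exact: cr.
- exact: coordM.
- exact: notM_mul.
- by apply: (mulfI p0); rewrite [LHS]mulrA -gE -mulrA E qE rmorphM /=; ring.
exists (k + 1), (t * s), h; split=> //; first exact: coordM.
  exact: notM_mul.
by rewrite -mulrA gE mulrCA tE expfzDr // expr1z; ring.
Qed.

Lemma local_val_exists f : f != 0 -> exists k, local_val f k.
Proof.
move=> f0; have [q q0 cqf] := GK_fraction f; have zq0 := zeval_neq0 q0.
have [k1 [s1 [h1 [cs1 ch1 ns1 nh1 E1]]]] := local_val_exists_coord (coord_zeval q) zq0.
have [k2 [s2 [h2 [cs2 ch2 ns2 nh2 E2]]]] :=
  local_val_exists_coord cqf (mulf_neq0 zq0 f0).
exists (k2 - k1), (s2 * h1), (s1 * h2).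
split; try exact: coordM; try exact: notM_mul.
apply: (@mulfI _ (zeval p ^ k1)); first by rewrite expfz_neq0.
rewrite [RHS]mulrA -expfzDr // addrCA subrr addr0 [RHS]mulrCA -E2.
by transitivity (s2 * f * (zeval p ^ k1 * h1)); [|rewrite -E1]; ring.
Qed.

Lemma local_val_neq0 f k : local_val f k -> f != 0.
Proof.
move=> [s [h [_ _ _ nh E]]]; apply/eqP => f0; apply: nh.
move/esym/eqP: E; rewrite f0 mulr0 mulf_eq0 expfz_eq0 (negPf p0) andbF => /eqP ->.
exact: M0.
Qed.

(** At [f = 0] no [k] qualifies, so the default is the dummy value required by [place]. *)
Definition local_ord f : int := xget 0 (local_val f).

Lemma local_ordP f : f != 0 -> local_val f (local_ord f).
Proof. by move=> /local_val_exists[k vk]; apply: (xgetPex 0); exists k. Qed.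

Lemma local_ordE f k : local_val f k -> local_ord f = k.
Proof.
by move=> vk; exact: local_val_uniq (local_ordP (local_val_neq0 vk)) vk.
Qed.

Lemma local_ordD f g : f != 0 -> g != 0 -> f + g != 0 ->
  Num.min (local_ord f) (local_ord g) <= local_ord (f + g).
Proof.
wlog le : f g / local_ord f <= local_ord g => [H|] f0 g0 s0.
  have /orP[le|le] := le_total (local_ord f) (local_ord g); first exact: H.
  by rewrite minC addrC; apply: H; rewrite // addrC.
rewrite (min_idPl le); have [s [h [cs ch ns nh E]]] := local_ordP f0.
have [s' [h' [cs' ch' ns' nh' E']]] := local_ordP g0.
have [j jE] : exists j : nat, local_ord g = local_ord f + j%:Z.
  by exists `|local_ord g - local_ord f|%N; lia.
(* This is the sum with the smaller power of [p] divided out; being in the coordinate ring, it has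
   nonnegative order. *)
pose w := s' * h + s * (zeval p ^+ j * h').
have cw : coord w.
  by apply: coordD; apply: coordM => //; apply: coordM => //; exact: coordX.
have wE : s * s' * (f + g) = zeval p ^ local_ord f * w.
  transitivity (s' * (s * f) + s * (s' * g)); first by ring.
  rewrite E E' jE expfzDr // -exprnP /w mulrDr; congr (_ + _); first exact: mulrCA.
  by rewrite -mulrA mulrCA.
have ss0 : s * s' != 0.
  by apply/eqP => ss0; have := notM_mul cs cs' ns ns'; rewrite ss0.
have w0 : w != 0.
  by have := mulf_neq0 ss0 s0; rewrite wE mulf_eq0 negb_or => /andP[].
have [k vw] := local_val_exists w0; have k0 := local_val_coord cw vw.
have [t [e [ct ce nt ne tE]]] := vw.
suff /local_ordE -> : local_val (f + g) (local_ord f + k) by rewrite lerDl.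
exists (t * (s * s')), e; split=> //; try by do 2?apply: coordM.
  by apply: notM_mul => //; [exact: coordM | exact: notM_mul].
by rewrite -mulrA wE mulrCA tE expfzDr // mulrA.
Qed.

Lemma place_of_prime : exists v : place iota,
  (forall f, coord f -> 0 <= v f) /\
  (forall f, coord f -> M f <-> vanishes_at v f).
Proof.
have v0 : local_ord 0 = 0.
  by apply: xgetPN => k /local_val_neq0; rewrite eqxx.
have vM f g : f != 0 -> g != 0 -> local_ord (f * g) = local_ord f + local_ord g.
  by move=> f0 g0; apply: local_ordE; apply: local_valM; exact: local_ordP.
have vc e : e != 0 -> local_ord (iota e) = 0.
  move=> e0; apply/local_ordE/local_val_off => // Me; apply: M1.
  by rewrite -(mulfV (_ : iota e != 0)) ?fmorph_eq0 // -fmorphV; exact: MM.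
have vn : exists2 t, t != 0 & local_ord t = 1.
  exists (zeval p) => //; apply: local_ordE; exists 1, 1.
  by split=> //; rewrite expr1z mulrC.
exists (Place v0 vM local_ordD vc vn) => /=; split=> f cf.
  have [->|f0] := eqVneq f 0; first by rewrite v0.
  by apply: local_val_coord (local_ordP f0).
split=> [Mf|[->|]] /=; first 1 last.
- exact: M0.
- by move=> vf; apply: contrapT => /(local_val_off cf)/local_ordE E; rewrite E in vf.
have [->|f0] := eqVneq f 0; [by left | right => /=].
have v := local_ordP f0; rewrite lt_def (local_val_coord cf v) andbT.
apply/eqP => vf0; rewrite vf0 in v; have [s [h [cs ch ns nh]]] := v.
by rewrite expr0z mul1r => E; apply: nh; rewrite -E mulrC; exact: MM.
Qed.

End LocalRing.

(** * Functions regular away from infinity *)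

(** Take a prime [M] containing the colon ideal [J] of the [s] with [s r] divisible by [p]. As
    [r^N - r] is divisible by [p], [r^(N-1) - 1] lies in [J], so [r] cannot lie in [M]. *)
Lemma place_off p r : irreducible_poly p -> coord r -> ~ zdiv p r ->
  exists v : place iota, [/\ (forall f, coord f -> 0 <= v f),
    vanishes_at v (zeval p) & ~ vanishes_at v r].
Proof.
move=> irr cr nr; pose J : set F := fun s => coord s /\ zdiv p (s * r).
have idJ : coord_ideal J.
  split=> [f []//||f g [cf zf] [cg zg]|f g [cf zf] cg].
  - by split=> //; rewrite mul0r; exact: zdiv0.
  - by split; [exact: coordD | rewrite mulrDl; exact: zdivD].
  - by split; [exact: coordM | rewrite mulrAC; exact: zdivM].
have [|M pM JM] := prime_ideal_exists idJ; first by move=> [_]; rewrite mul1r.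
have [[_ _ MD MM] M1 _] := pM.
have [|v [vreg vM]] := place_of_prime irr pM.
  by apply: JM; split=> //; exists r.
exists v; split=> //; first by apply/vM => //; apply: JM; split=> //; exists r.
move=> /(vM _ cr) Mr; have [N N1 /(_ r cr) zr] := zdiv_power irr.
apply: M1; rewrite -(subKr (r ^+ N.-1) 1); apply: MD.
  have -> : N.-1 = N.-2.+1 by lia.
  by rewrite exprS; apply: MM => //; exact: coordX.
rewrite -mulrN1; apply: MM; last by rewrite -(rmorphN1 iota).
apply: JM; split; first by apply: coordB => //; exact: coordX.
by rewrite mulrBl -exprSr mul1r prednK //; lia.
Qed.

(** The denominator [q] is cleared one irreducible factor [p] at a time: if [p] did not divide
    [q f], some finite place would have [p] vanish but not [q f], although [q f] is [p] times a
    regular function. *)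
Lemma regular_coord f : (forall v, v <> Pinf -> 0 <= v f) -> coord f.
Proof.
move=> freg; have [q q0 cqf] := GK_fraction f.
have [N] := ubnP (size q); elim: N q q0 cqf => // N IH q q0 cqf; rewrite ltnS => sq.
have [sq1|sq1] := leqP (size q) 1.
  have qE := size1_polyC sq1; rewrite qE zevalC in cqf.
  have c0 : iota q`_0 != 0 by rewrite fmorph_eq0 -(polyC_eq0 q`_0) -qE.
  by rewrite -[f](mulKf c0) -fmorphV; exact: coordM.
have [p irr /dvdpP[q1 qE]] := irreducible_factor sq1.
have p0 := irredp_neq0 irr; have q10 : q1 != 0.
  by apply: contraNneq q0 => q10; rewrite qE q10 mul0r.
have zE : zeval q * f = zeval p * (zeval q1 * f).
  by rewrite qE rmorphM /= mulrC mulrCA mulrA mulrC mulrA.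
have [[r cr rE]|nz] := pselect (zdiv p (zeval q * f)).
  apply: (IH q1) => //.
    by rewrite (mulfI (zeval_neq0 p0) (etrans (esym zE) rE)).
  apply: leq_trans sq; rewrite qE size_mul //; have := irr.1.
  move: q10; rewrite -size_poly_gt0.
  by move: (size q1) (size p) => [|i] [|[|j]] //=; rewrite ?addnS /=; lia.
have [v [vreg vp nv]] := place_off irr cqf nz.
have vinf : v <> Pinf by move=> vE; have := vreg x coord_x; rewrite vE leNgt Pinf_x.
case: nv; rewrite zE; apply: vanishesM => //.
by apply: regularM; [apply: vreg | apply: freg].
Qed.

Lemma coord_not_frobenius r : coord r -> r != 0 ->
  Pinf r != - (2 * GK_genus n - 1)%N%:Z.
Proof.
move=> cr r0; have [l [be [ga H]]] := coord_weight1 cr r0.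
by rewrite H // eqr_opp eqz_nat; apply/eqP/GK_frobenius.
Qed.

(** [e] is chosen before [v]: one value serves every place over [(al, 0, 0)], including those not
    known to be the given [Pj]. *)
Lemma coord_value al r : coord r -> exists e : K, forall v,
  vanishes_at v (x - iota al) -> vanishes_at v y -> vanishes_at v z ->
  vanishes_at v (r - iota e).
Proof.
elim=> [e||||f1 f2 c1 [e1 H1] c2 [e2 H2]|f1 f2 c1 [e1 H1] c2 [e2 H2]].
- by exists e => v _ _ _; left; rewrite subrr.
- by exists al.
- by exists 0 => v; rewrite rmorph0 subr0.
- by exists 0 => v; rewrite rmorph0 subr0.
- exists (e1 + e2) => v vx vy vz; rewrite rmorphD opprD addrACA.
  by apply: vanishesD; [exact: H1 | exact: H2].
- exists (e1 * e2) => v vx vy vz.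
  have -> : f1 * f2 - iota (e1 * e2) = (f1 - iota e1) * f2 + (f2 - iota e2) * iota e1.
    by rewrite rmorphM; ring.
  have v0 : 0 <= v x.
    by rewrite -(subrK (iota al) x) regularD ?ord_iota ?vanishes_regular.
  apply: vanishesD; apply: vanishesM; [exact: H1 | exact: coord_regular | exact: H2 |].
  by rewrite ord_iota.
Qed.

(** * The residue theorem for a simple pole *)

Context (root : 'I_n -> K) (root_inj : injective root).
Context (rootP : forall j, root j ^+ n + root j = 0).

Lemma GK_xnx_prod : x ^+ n + x = \prod_j (x - iota (root j)).
Proof.
have sz : size ('X^n + 'X : {poly K}) = n.+1.
  by rewrite size_polyDl size_polyXn // size_polyX; lia.
have lc : lead_coef ('X^n + 'X : {poly K}) = 1.
  by rewrite lead_coefDl ?lead_coefXn // size_polyXn size_polyX; lia.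
have E : 'X^n + 'X = \prod_j ('X - (root j)%:P).
  rewrite [LHS](@all_roots_prod_XsubC _ _ (codom root)).
  - by rewrite lc scale1r big_map enumT.
  - by rewrite sz size_codom card_ord.
  - by apply/allP => _ /codomP[j ->]; rewrite rootE !hornerE rootP.
  - by rewrite uniq_rootsE; exact/injectiveP.
have := congr1 (fun q => (map_poly iota q).[x]) E.
rewrite rmorphD /= map_polyXn map_polyX !hornerE => ->.
rewrite rmorph_prod horner_prod; apply: eq_bigr => j _.
by rewrite /= map_polyXsubC hornerXsubC.
Qed.

Lemma vanishesM_inv v f g : 0 <= v f -> 0 <= v g -> vanishes_at v (f * g) ->
  vanishes_at v f \/ vanishes_at v g.
Proof.
move=> vf vg [/eqP|]; first by rewrite mulf_eq0 => /orP[]/eqP; [left; left | right; left].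
have [->|f0] := eqVneq f 0; first by left; left.
have [->|g0] := eqVneq g 0; first by right; left.
rewrite ordM // => vfg; have [vf0|vf0] := ltP 0 (v f); first by left; right.
by right; right; lia.
Qed.

Lemma vanishes_prod_inv v (I : Type) (s : seq I) (P : pred I) (G : I -> F) :
  (forall i, 0 <= v (G i)) -> vanishes_at v (\prod_(i <- s | P i) G i) ->
  exists2 i, P i & vanishes_at v (G i).
Proof.
move=> Greg; have Preg t : 0 <= v (\prod_(i <- t | P i) G i).
  by apply: (big_ind (fun f => 0 <= v f)) => //; [rewrite ord1 | move=> *; exact: regularM].
elim: s => [|i s IH].
  by rewrite big_nil => -[/eqP|]; rewrite ?oner_eq0 // ord1 ltxx.
rewrite big_cons; case: ifP => [Pi|_]; last exact: IH.
by case/(vanishesM_inv (Greg i) (Preg s)) => [Gi|/IH//]; exists i.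
Qed.

Section SimplePole.
Context (j : 'I_n) (Pj : place iota).
Context (Pj_x : vanishes_at Pj (x - iota (root j))).
Context (Pj_y : vanishes_at Pj y) (Pj_z : vanishes_at Pj z).

Lemma ord_x_sub v al be : al != be -> vanishes_at v (x - iota al) ->
  x - iota be != 0 /\ v (x - iota be) = 0.
Proof.
move=> ab [/eqP|va]; first by rewrite subr_eq0 (negPf (GK_x_neq al)).
have d0 : iota (al - be) != 0 by rewrite fmorph_eq0 subr_eq0.
have -> : x - iota be = iota (al - be) + (x - iota al) by rewrite rmorphB; ring.
by have [] := @ordD_lt _ _ _ v _ (x - iota al) d0; rewrite ord_iota.
Qed.

Lemma z_neq0 : z != 0.
Proof.
apply/eqP => z0; have [_ _] := GK_ord_inf1 Pinf_x; rewrite z0 ord0_dummy.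
by have := expn_gt0 n 3; lia.
Qed.

(* The residue theorem for f dz: up to z, f is an element r of the coordinate
   ring vanishing at all zeros of z but Pj, so r is congruent mod z to a multiple
   of the interpolating function e, whose leading monomial x^(n-1) y^(n^2-1) would
   force the pole order 2g - 1 on (r - l e) / z. *)
Lemma simple_pole_removable f :
  (forall v, v <> Pinf -> v <> Pj -> 0 <= v f) -> -1 <= Pj f ->
  - (2 * GK_genus n - 2)%N%:Z <= Pinf f -> coord f.
Proof.
move=> freg fj finf; have [->//|f0] := eqVneq f 0.
have z0 := z_neq0; have [xinf yinf zinf] := GK_ord_inf1 Pinf_x.
have n0 : (0 < n)%N by lia.
have vx v : v <> Pinf -> 0 <= v x.
  by move=> vinf; rewrite leNgt; apply/negP => /GK_inf_unique.
have cr : coord (z * f).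
  apply: regular_coord => v vinf; have vz : 0 <= v z by exact: coord_regular (vx _ vinf) _.
  have [->|vj] := pselect (v = Pj); last exact/regularM/freg.
  by rewrite ordM //; case: Pj_z => [/eqP|]; [rewrite (negPf z0) | lia].
(* At a zero of [z] one has [y^(n^2) = y]: the first factor kills the zeros with [y] nonzero, the
   product those with [y = 0] and [x = a_i] for [i] other than [j]. At [Pj] neither factor
   vanishes. *)
pose e := (1 - y ^+ (n ^ 2 - 1)) * \prod_(i | i != j) (x - iota (root i)).
have ce : coord e.
  apply: coordM; first by apply: coordB => //; exact: coordX.
  by apply: coord_prod => i _; exact: coordB.
have [l Hl] := coord_value (root j) cr; have [ka Hka] := coord_value (root j) ce.
have n21 : (0 < n ^ 2 - 1)%N by rewrite expnS expn1; nia.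
have ka0 : ka != 0.
  apply/eqP => ka0; have := Hka _ Pj_x Pj_y Pj_z; rewrite ka0 rmorph0 subr0.
  have Pjx : 0 <= Pj x.
    by rewrite -(subrK (iota (root j)) x) regularD ?ord_iota ?vanishes_regular.
  have yreg : 0 <= Pj (1 - y ^+ (n ^ 2 - 1)).
    by apply: coord_regular => //; apply: coordB => //; exact: coordX.
  have xreg i : 0 <= Pj (x - iota (root i)).
    by apply: coord_regular => //; exact: coordB.
  case/vanishesM_inv => //.
  - apply: coord_regular => //; apply: coord_prod => i _; exact: coordB.
  - move=> H; have : vanishes_at Pj (iota 1).
      rewrite rmorph1 -(subrK (y ^+ (n ^ 2 - 1)) 1); apply: vanishesD => //.
      rewrite -(prednK n21) exprS; apply: vanishesM => //.
      by apply: regularX; exact: vanishes_regular.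
    by move/vanishes_iota/eqP; rewrite oner_eq0.
  - case/vanishes_prod_inv => // i ij; have := @ord_x_sub _ _ (root i) _ Pj_x.
    rewrite (inj_eq root_inj) eq_sym => /(_ ij)[xi0 xi] [/eqP|].
      by rewrite (negPf xi0).
    by rewrite xi ltxx.
pose w := z * f - iota (l / ka) * e.
have cw : coord w by apply: coordB => //; exact: coordM.
(* By [place_off] for the irreducible ['X], divisibility by [z] only requires [w] to vanish wherever
   [z] does. *)
have [[r' cr' wE]|nw] := pselect (zdiv 'X w); last first.
  have irrX : irreducible_poly ('X : {poly K}).
    by rewrite -['X]subr0 -polyC0; exact: irredp_XsubC.
  have [v [vreg vz nv]] := place_off irrX cw nw; rewrite zevalX in vz.
  have vinf : v <> Pinf.
    by move=> vE; have := vreg x coord_x; rewrite vE leNgt Pinf_x.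
  case: nv; have [[vy vxj]|nvj] :=
    pselect (vanishes_at v y /\ vanishes_at v (x - iota (root j))).
    have -> : w = (z * f - iota l) - iota (l / ka) * (e - iota ka).
      rewrite /w -[in iota l](divfK ka0 l) rmorphM; ring.
    apply: vanishesD; first exact: Hl.
    by apply: vanishesN; rewrite mulrC; apply: vanishesM; rewrite ?ord_iota //; exact: Hka.
  have vj : v <> Pj by move=> vj; apply: nvj; rewrite vj.
  apply: vanishesD; first by apply: vanishesM => //; exact: freg.
  apply: vanishesN; rewrite mulrC; apply: vanishesM; last by rewrite ord_iota.
  have yreg : 0 <= v (1 - y ^+ (n ^ 2 - 1)).
    by apply: vreg; apply: coordB => //; exact: coordX.
  have xreg i : 0 <= v (x - iota (root i)) by apply: vreg; exact: coordB.
  have : vanishes_at v (y * (1 - y ^+ (n ^ 2 - 1))).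
    have -> : y * (1 - y ^+ (n ^ 2 - 1)) = - z ^+ a.
      rewrite GK_eq_yz mulrBr mulr1 -exprS subn1 prednK ?expn_gt0 ?n0 //.
      by rewrite opprB.
    apply: vanishesN; rewrite addn1 exprS; apply: vanishesM => //.
    by apply: regularX; exact: vanishes_regular.
  case/(vanishesM_inv (vreg _ coord_y) yreg) => [vy|v1]; last first.
    by apply: vanishesM => //; apply: vreg; apply: coord_prod => i _; exact: coordB.
  have : vanishes_at v (\prod_i (x - iota (root i))).
    rewrite -GK_xnx_prod (GK_eq_y hF) exprS; apply: vanishesM => //.
    by apply: regularX; exact: vreg.
  case/vanishes_prod_inv => // i _ vi; have [ij|ij] := eqVneq i j.
    by case: nvj; rewrite -ij.
  rewrite /e mulrC; apply: vanishesM => //; rewrite (bigD1 i) //=.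
  by apply: vanishesM => //; apply: vreg; apply: coord_prod => k _; exact: coordB.
rewrite zevalX in wE.
suff l0 : l = 0.
  rewrite /w l0 mul0r rmorph0 mul0r subr0 in wE.
  by rewrite (mulfI z0 wE).
apply: contrapT => /eqP l0; have lk0 : iota (l / ka) != 0.
  by rewrite fmorph_eq0 mulf_neq0 ?invr_eq0.
have y0 := GK_y_neq0.
have y21 : y ^+ (n ^ 2 - 1) != 0 by rewrite expf_neq0.
have [ey0 vey] : 1 - y ^+ (n ^ 2 - 1) != 0 /\
    Pinf (1 - y ^+ (n ^ 2 - 1)) = - ((n ^ 2 - 1) * (a * n))%N%:Z.
  have -> : - ((n ^ 2 - 1) * (a * n))%N%:Z = Pinf (- y ^+ (n ^ 2 - 1)).
    by rewrite ordN ordXz yinf mulNr -PoszM mulnC.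
  rewrite addrC; apply: ordD_lt; first by rewrite oppr_eq0.
  by rewrite ord1 ordN ordXz yinf nmulr_rlt0 ?oppr_lt0 ?ltz_nat ?muln_gt0 ?n0 ?addn1.
have xi i : x - iota (root i) != 0 /\ Pinf (x - iota (root i)) = - c%:Z.
  rewrite -xinf; apply: ordD_lt => [|_]; last by rewrite ordN ord_iota.
  by rewrite -(rmorph0 iota) GK_x_neq.
have [ex0 vex] : \prod_(i | i != j) (x - iota (root i)) != 0 /\
    Pinf (\prod_(i | i != j) (x - iota (root i))) = - ((n - 1) * c)%N%:Z.
  have [-> ->] := ord_prod Pinf (index_enum 'I_n) (fun i (_ : i != j) => (xi i).1).
  split=> //; rewrite (eq_bigr (fun=> - c%:Z)) => [|i _]; last by have [] := xi i.
  by rewrite sumr_const cardC1 card_ord mulNrn -mulr_natr natz -PoszM mulnC subn1.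
have e0 : e != 0 by rewrite mulf_neq0.
have ve : Pinf (iota (l / ka) * e) = - (2 * GK_genus n - 1 + b)%N%:Z.
  by rewrite ordM // ord_iota add0r ordM // vey vex -opprD -PoszD GK_top_weight.
(* [z * f] has pole order at most [2g - 2 + b], one less than [e], so no cancellation occurs. *)
have [w0 vw] : - (iota (l / ka) * e) + z * f != 0 /\
    Pinf (- (iota (l / ka) * e) + z * f) = Pinf (- (iota (l / ka) * e)).
  apply: ordD_lt => [|_]; first by rewrite oppr_eq0 mulf_neq0.
  have : (0 < 2 * GK_genus n - 1)%N by rewrite double_GK_genus // addn1.
  rewrite ordN ve ordM // zinf; move: finf; clear.
  by move: (GK_genus n) (n ^ 3)%N (Pinf f) => G B I; lia.
have {}wE : - (iota (l / ka) * e) + z * f = z * r' by rewrite -wE addrC.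
have r0 : r' != 0 by apply: contraNneq w0 => r0; rewrite wE r0 mulr0.
have /eqP[] := coord_not_frobenius cr' r0.
move: vw; rewrite wE ordN ve ordM // zinf; clear.
by move: (GK_genus n) (n ^ 3)%N (Pinf r') => G B I; lia.
Qed.

End SimplePole.

(** * Pure gaps *)

(** Terms of the normal form do not cancel at [Pinf], and each factor [z] costs [b >= 1], so
    exponents of [z] above [B] cannot occur. *)
Lemma coord_span B : exists (I : finType) (e : I -> F), forall r,
  coord r -> - B%:Z <= Pinf r -> exists c : I -> K, r = \sum_i iota (c i) * e i.
Proof.
pose e (t : idx * 'I_B.+1) := z ^+ t.2 * (y ^+ t.1.2 * x ^+ t.1.1).
exists (idx * 'I_B.+1)%type, e => r cr; have [->|r0] := eqVneq r 0.
  move=> _; exists (fun=> 0); rewrite big1 // => i _.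
  by rewrite rmorph0 mul0r.
have [C rE] := coord_nform cr; rewrite rE in r0 * => rB.
have [xE yE zE] := GK_ord_inf1 Pinf_x.
have [i0 [_ Wmax /(_ Pinf 1%N)]] := nform_weight r0.
rewrite !muln1 => /(_ isT xE yE zE) vr; rewrite vr lerN2 lez_nat in rB.
have szC i : (size (C i) <= B.+1)%N.
  have [->|Ci] := eqVneq (C i) 0; first by rewrite size_poly0.
  have := leq_trans (Wmax i Ci) rB; rewrite /nform_wt => /(leq_trans (leq_addl _ _)).
  have := leq_pmulr (size (C i)).-1 (_ : 0 < b)%N; rewrite expn_gt0 => /(_ _)/leq_trans.
  have n0 : (0 < n)%N by lia.
  move=> H /H; rewrite n0 => /(_ isT); lia.
exists (fun t : idx * 'I_B.+1 => (C t.1)`_t.2).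
rewrite -(pair_bigA _ (fun (i : idx) (k : 'I_B.+1) => iota (C i)`_k * e (i, k))).
apply: eq_bigr => i _; rewrite /zeval (@horner_coef_wide _ B.+1) ?size_map_poly //.
by rewrite mulr_suml; apply: eq_bigr => k _; rewrite coef_map /e -mulrA.
Qed.

Context (P : 'I_n -> place iota).
Context (P_x : forall j, vanishes_at (P j) (x - iota (root j))).
Context (P_y : forall j, vanishes_at (P j) y) (P_z : forall j, vanishes_at (P j) z).

Lemma P_inj : injective P.
Proof.
move=> i j PE; apply/root_inj/eqP; apply: contrapT => /negP ij.
have [x0 xj] := ord_x_sub ij (P_x i); case: (P_x j) => [/eqP|].
  by rewrite (negPf x0).
by rewrite -PE xj ltxx.
Qed.

Lemma P_regular j r : coord r -> 0 <= P j r.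
Proof.
apply: coord_regular; rewrite -(subrK (iota (root j)) x).
by rewrite regularD ?ord_iota ?vanishes_regular.
Qed.

Lemma P_neq_inf j : P j <> Pinf.
Proof. by move=> PE; have := P_regular j coord_x; rewrite PE leNgt Pinf_x. Qed.

Lemma ord_inf_sub_root (I : finType) (A : {pred I}) (s : I -> K) :
  \prod_(i in A) (x - iota (s i)) != 0 /\
  Pinf (\prod_(i in A) (x - iota (s i))) = - (#|A| * c)%N%:Z.
Proof.
have [xinf _ _] := GK_ord_inf1 Pinf_x.
have xi i : x - iota (s i) != 0 /\ Pinf (x - iota (s i)) = - c%:Z.
  rewrite -xinf; apply: ordD_lt => [|_]; last by rewrite ordN ord_iota.
  by rewrite -(rmorph0 iota) GK_x_neq.
have [-> ->] := ord_prod Pinf (index_enum I) (fun i (_ : i \in A) => (xi i).1).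
split=> //; rewrite (eq_bigr (fun=> - c%:Z)) => [|i _]; last by have [] := xi i.
by rewrite sumr_const mulNrn -mulr_natr natz -PoszM mulnC.
Qed.

Context (m : nat) (hm1 : (1 <= m)%N) (hmn : (m <= n)%N) (alpha : nat).
Context (alpha_lt : (alpha < 2 * GK_genus n - 1)%N).

Local Notation Q := (fun i : 'I_m => P (widen_ord hmn i)).
Local Notation R := (fcons Pinf Q).
Local Notation u := (fcons alpha (fun _ : 'I_m => 1%N)).

Lemma points_inj : injective R.
Proof.
move=> i j; rewrite /fcons.
case: (unliftP ord0 i) => [i'|] ->; case: (unliftP ord0 j) => [j'|] -> //.
- by move=> /P_inj E; congr lift; apply/val_inj; move/(congr1 val): E.
- by move/P_neq_inf.
- by move/esym/P_neq_inf.
Qed.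

Lemma div_Pinf : div_of R u Pinf = alpha%:Z.
Proof. by have := div_of_point u ord0 points_inj; rewrite /fcons unlift_none. Qed.

Lemma div_P i : div_of R u (Q i) = 1.
Proof. by have := div_of_point u (lift ord0 i) points_inj; rewrite /fcons liftK. Qed.

Lemma div_off v : v <> Pinf -> (forall i, v <> Q i) -> div_of R u v = 0.
Proof.
move=> vinf vQ; apply: div_of_off => i; rewrite /fcons.
by case: unliftP => [i'|] _.
Qed.

(** [z] vanishes at every [P_i], so multiplication by [z] sends [L(G)] into the part of the
    coordinate ring with pole order at most [alpha + b]. *)
Lemma GK_has_dim : exists d, has_dim iota (RRspace (div_of R u)) d.
Proof.
have z0 := z_neq0; have [I [e spane]] := coord_span (alpha + b).
apply: (@has_dim_RRspace _ _ _ I (fun i => z^-1 * e i)) => f [->|Gf].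
  by exists (fun=> 0); rewrite big1 // => i _; rewrite rmorph0 mul0r.
have [f0|f0] := eqVneq f 0.
  by exists (fun=> 0); rewrite f0 big1 // => i _; rewrite rmorph0 mul0r.
have cz : coord (z * f).
  apply: regular_coord => v vinf; have := Gf v.
  have [[i ->]|vQ] := pselect (exists i, v = Q i).
    rewrite div_P ordM //; case: (P_z (widen_ord hmn i)) => [/eqP|].
      by rewrite (negPf z0).
    by move: (P _ z) (P _ f) => A B; lia.
  rewrite div_off // => [|i vi]; last by apply: vQ; exists i.
  rewrite addr0; apply: regularM; apply: coord_regular coord_z.
  by rewrite leNgt; apply/negP => /GK_inf_unique.
have [|c cE] := spane _ cz.
  have [_ _ zE] := GK_ord_inf1 Pinf_x.
  by rewrite ordM // zE; have := Gf Pinf; rewrite div_Pinf PoszD; lia.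
exists c; apply: (mulfI z0); rewrite cE mulr_sumr.
by apply: eq_bigr => i _; rewrite mulrCA [z * _]mulrA mulfV // mul1r.
Qed.

(** [t] removes the simple poles and would raise the pole order at [Pinf] from [alpha] to the
    excluded [2g - 1]. *)
Lemma ord_inf_neq f t : f != 0 -> (forall v, 0 <= v f + div_of R u v) ->
  coord t -> t != 0 -> Pinf t = - (2 * GK_genus n - 1 - alpha)%N%:Z ->
  (forall i, vanishes_at (Q i) t) -> Pinf f <> - alpha%:Z.
Proof.
move=> f0 Gf ct t0 vt tQ vf.
have ctf : coord (t * f).
  apply: regular_coord => v vinf; have := Gf v.
  have [[i ->]|vQ] := pselect (exists i, v = Q i).
    rewrite div_P ordM //; case: (tQ i) => [/eqP|]; first by rewrite (negPf t0).
    by move: (P _ t) (P _ f) => A B; lia.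
  rewrite div_off // => [|i vi]; last by apply: vQ; exists i.
  rewrite addr0; apply: regularM; apply: coord_regular ct.
  by rewrite leNgt; apply/negP => /GK_inf_unique.
have /eqP[] := coord_not_frobenius ctf (mulf_neq0 t0 f0).
rewrite ordM // vt vf; move: alpha_lt; clear.
by move: (2 * _)%N => N; lia.
Qed.

(** The product [t] removes the poles at the other points and is a unit at [Q i]. The strict
    inequality keeps the pole order of [t * f] at [Pinf] within [2g - 2], so the pole at [Q i] is
    removable. *)
Lemma ord_P_neq f i : f != 0 -> (forall v, 0 <= v f + div_of R u v) ->
  ((m - 1) * c < 2 * GK_genus n - 1 - alpha)%N -> Q i f <> - 1.
Proof.
move=> f0 Gf lt vf.
pose t := \prod_(k | k \in predC1 i) (x - iota (root (widen_ord hmn k))).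
have [t0 vt] := ord_inf_sub_root (predC1 i) (fun k => root (widen_ord hmn k)).
rewrite -/t cardC1 card_ord -subn1 in t0 vt.
have ct : coord t by apply: coord_prod => k _; exact: coordB.
have tQ k : k != i -> vanishes_at (Q k) t.
  move=> ki; rewrite /t (bigD1 k) //=; apply: vanishesM; first exact: P_x.
  by apply: P_regular; apply: coord_prod => k' _; exact: coordB.
have tQi : Q i t = 0.
  have xi k : k \in predC1 i -> x - iota (root (widen_ord hmn k)) != 0 /\
      Q i (x - iota (root (widen_ord hmn k))) = 0.
    move=> ki; apply: ord_x_sub (P_x (widen_ord hmn i)).
    by rewrite (inj_eq root_inj) eq_sym; exact: ki.
  have [_ ->] := ord_prod (Q i) (index_enum 'I_m) (fun k ki => (xi k ki).1).
  by rewrite big1 // => k /xi[].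
have ctf : coord (t * f).
  have := @simple_pole_removable (widen_ord hmn i) (Q i) (P_x _) (P_y _) (P_z _).
  apply.
  - move=> v vinf vi; have := Gf v.
    have [[k vk]|vQ] := pselect (exists k, v = Q k).
      have ki : k != i by apply/eqP => ki; apply: vi; rewrite vk ki.
      rewrite vk div_P ordM //; case: (tQ k ki) => [/eqP|].
        by rewrite (negPf t0).
      by move: (P _ t) (P _ f) => A B; lia.
    rewrite div_off // => [|k vk]; last by apply: vQ; exists k.
    rewrite addr0; apply: regularM; apply: coord_regular ct.
    by rewrite leNgt; apply/negP => /GK_inf_unique.
  - by rewrite ordM // tQi vf.
  - rewrite ordM // vt; have := Gf Pinf; rewrite div_Pinf; move: lt alpha_lt; clear.
    by move: (Pinf f) (2 * _)%N ((m - 1) * c)%N => A N M; lia.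
have := P_regular (widen_ord hmn i) ctf.
by rewrite ordM // tQi vf.
Qed.

Lemma GK_pure_gap : gaps R u ->
  ((m - 1) * c < 2 * GK_genus n - 1 - alpha)%N ->
  (exists t, [/\ coord t, t != 0, Pinf t = - (2 * GK_genus n - 1 - alpha)%N%:Z
    & forall i, vanishes_at (Q i) t]) -> pure_gap R u.
Proof.
move=> gap lt [t [ct t0 vt tQ]].
apply: pure_gap_crit gap GK_has_dim _; first exact: points_inj.
move=> j f f0 Gf; rewrite /fcons; case: unliftP => [i|] _.
  exact: ord_P_neq.
exact: ord_inf_neq vt tQ.
Qed.

(** Each [x - a_k] has the pole order [c] of [x], so exchanging [m] factors creates the zeros
    without changing the order at [Pinf]. *)
Lemma GK_pole_witness l be ga : (m <= l)%N ->
  weight l be ga = (2 * GK_genus n - 1 - alpha)%N ->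
  exists t, [/\ coord t, t != 0, Pinf t = - (2 * GK_genus n - 1 - alpha)%N%:Z
    & forall i, vanishes_at (Q i) t].
Proof.
move=> ml <-; have [xE yE zE] := GK_ord_inf1 Pinf_x.
have x0 : x != 0 by rewrite -(rmorph0 iota) GK_x_neq.
have y0 := GK_y_neq0; have z0 := z_neq0.
have [p0 vp] := ord_inf_sub_root 'I_m (fun k => root (widen_ord hmn k)).
have cm : coord (x ^+ (l - m) * y ^+ be * z ^+ ga).
  by do 2?apply: coordM; exact: coordX.
exists (\prod_(k in 'I_m) (x - iota (root (widen_ord hmn k))) *
  (x ^+ (l - m) * y ^+ be * z ^+ ga)); split.
- by apply: coordM => //; apply: coord_prod => k _; exact: coordB.
- by rewrite !mulf_neq0 ?expf_neq0.
- rewrite !ordM ?mulf_neq0 ?expf_neq0 // vp !ordXz xE yE zE card_ord.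
  rewrite !mulNr -!opprD -!PoszM -!PoszD; congr (- Posz _).
  by rewrite -{2}(subnKC ml); ring.
- move=> i; rewrite (bigD1 i) //= -[X in vanishes_at _ X]mulrA; apply: vanishesM; first exact: P_x.
  apply: P_regular; apply: coordM => //.
  by apply: coord_prod => k _; exact: coordB.
Qed.

Lemma GK_pole_witness0 be ga :
  (be * (a * n) + ga * b = 2 * GK_genus n - 1 - alpha)%N ->
  exists t, [/\ coord t, t != 0, Pinf t = - (2 * GK_genus n - 1 - alpha)%N%:Z
    & forall i, vanishes_at (Q i) t].
Proof.
move=> E; have [_ yE zE] := GK_ord_inf1 Pinf_x.
have y0 := GK_y_neq0; have z0 := z_neq0.
exists (y ^+ be * z ^+ ga); split.
- by apply: coordM; exact: coordX.
- by rewrite mulf_neq0 ?expf_neq0.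
- rewrite ordM ?expf_neq0 // !ordXz yE zE -E.
  by rewrite !mulNr -opprD -!PoszM -PoszD; congr (- Posz _); ring.
(* Since [alpha < 2g - 1], [be] and [ga] are not both 0, so a factor [y] or [z] is present. *)
move=> i; have [be0|be0] := posnP be.
  have ga0 : (0 < ga)%N.
    by case: posnP => // ga0; move: E alpha_lt; rewrite be0 ga0; clear; lia.
  rewrite be0 mul1r -(prednK ga0) exprS; apply: vanishesM; first exact: P_z.
  by apply: P_regular; exact: coordX.
rewrite -(prednK be0) exprS -mulrA; apply: vanishesM; first exact: P_y.
by apply: P_regular; apply: coordM; exact: coordX.
Qed.

End GKCurve.

(** * From projective centres to vanishing conditions *)

Lemma centered_at_infinity (K F : fieldType) (iota : {rmorphism K -> F})
    (v : place iota) (x y z : F) :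
  centered_at v [tuple x; y; z; 1] [tuple 1; 0; 0; 0] -> v x < 0.
Proof.
move=> [[[|[|[|[|//]]]] lk] [/=]]; rewrite !(tnth_nth 0) /=;
  try by move=> _ /eqP.
move=> x0 _ /(_ (Ordinal (isT : 3 < 4)%N)); rewrite !(tnth_nth 0) /=.
rewrite mul0r rmorph0 subr0 div1r => -[/eqP|]; first by rewrite invr_eq0 (negPf x0).
by rewrite ordV oppr_gt0.
Qed.

Lemma centered_at_affine (K F : fieldType) (iota : {rmorphism K -> F})
    (v : place iota) (x y z : F) (r : K) :
  centered_at v [tuple x; y; z; 1] [tuple r; 0; 0; 1] ->
  [/\ vanishes_at v (x - iota r), vanishes_at v y & vanishes_at v z].
Proof.
move=> [[[|[|[|[|//]]]] lk] [/=]]; rewrite !(tnth_nth 0) /=;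
  try by move=> _ /eqP.
all: move=> x0 r0 H;
  have := H (Ordinal (isT : 0 < 4)%N); have := H (Ordinal (isT : 1 < 4)%N);
  have := H (Ordinal (isT : 2 < 4)%N); have := H (Ordinal (isT : 3 < 4)%N);
  rewrite !(tnth_nth 0) /= ?divr1 ?mul0r ?rmorph0 ?subr0 //.
(* What remains is the chart given by [x], with [r] nonzero: there [1 / x] takes the value [1 / r],
   so [x] is a unit at [v] and multiplying by it returns to affine coordinates. *)
move=> v1 vz vy _; have ir0 : iota r != 0 by rewrite fmorph_eq0.
have vV : 0 <= v x^-1.
  rewrite -[x^-1]div1r -(subrK (iota (1 / r)) (1 / x)).
  by rewrite regularD ?ord_iota ?vanishes_regular.
have vx : v x = 0.
  have [] := @ordD_lt _ _ _ v (iota (1 / r)) (1 / x - iota (1 / r)).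
  - by rewrite fmorph_eq0 div1r invr_eq0.
  - by case: v1 => [->|v1 _]; rewrite ?eqxx // ord_iota.
  by rewrite addrC subrK ord_iota div1r ordV => _ /eqP; rewrite oppr_eq0 => /eqP.
have vx0 : 0 <= v x by rewrite vx.
split.
- have -> : x - iota r = - (1 / x - iota (1 / r)) * (x * iota r).
    by rewrite fmorph_div rmorph1; field; rewrite x0 ir0.
  by apply: vanishesM; [exact: vanishesN | rewrite regularM ?ord_iota].
- by rewrite -(divfK x0 y); exact: vanishesM.
- by rewrite -(divfK x0 z); exact: vanishesM.
Qed.

Theorem proposition4p4 (n : nat) (hn2 : (2 <= n)%N)
    (hn : exists p k : nat, [/\ prime p, (0 < k)%N & n = (p ^ k)%N])
    (K : finFieldType) (hK : #|K| = (n ^ 6)%N)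
    (F : fieldType) (iota : {rmorphism K -> F}) (x y z : F)
    (hF : GK_function_field n iota x y z)
    (Pinf : place iota)
    (hPinf : centered_at Pinf [tuple x; y; z; 1] [tuple 1; 0; 0; 0])
    (root : 'I_n -> K) (root_inj : injective root)
    (rootP : forall j, root j ^+ n + root j = 0)
    (P : 'I_n -> place iota)
    (hP : forall j, centered_at (P j) [tuple x; y; z; 1]
                                      [tuple root j; 0; 0; 1])
    (m : nat) (hm1 : (1 <= m)%N) (hmn : (m <= n)%N) (alpha : nat) :
  let g := GK_genus n in
  let a := (n ^ 2 - n + 1)%N in
  let b := (n ^ 3)%N in
  let c := (n ^ 3 + 1)%N in
  let R := fcons Pinf (fun j : 'I_m => P (widen_ord hmn j)) in
  let u := fcons alpha (fun _ : 'I_m => 1%N) in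
  (alpha < 2 * g - 1)%N ->
  gaps R u ->
  (exists lambda beta gamma : nat, (m <= lambda)%N /\
     (lambda * c + beta * (a * n) + gamma * b = 2 * g - 1 - alpha)%N)
  \/ (((m - 1) * c <= 2 * g - 1 - alpha)%N /\
      exists beta gamma : nat,
        (beta * (a * n) + gamma * b = 2 * g - 1 - alpha)%N) ->
  pure_gap R u.
Proof.
move=> g a b c R u lt gap hyp.
have Pinf_x := centered_at_infinity hPinf.
have P_x j := (let: And3 H _ _ := centered_at_affine (hP j) in H).
have P_y j := (let: And3 _ H _ := centered_at_affine (hP j) in H).
have P_z j := (let: And3 _ _ H := centered_at_affine (hP j) in H).
apply: (GK_pure_gap hn2 hn hK hF Pinf_x root_inj rootP P_x P_y P_z hm1 lt gap).
  case: hyp => [[l [be [ga [ml E]]]]|[le [be [ga E]]]].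
    have : ((m - 1) * c < l * c)%N by rewrite ltn_pmul2r /c ?addn1 //; lia.
    by rewrite -/g -/c -E -addnA => /leq_trans; apply; exact: leq_addr.
  (* Equality would write [(m - 1) c] as a combination of [a n] and [b], which forces [m = 1] and
     hence [alpha >= 2g - 1]. *)
  rewrite -/g -/c ltn_neqAle le andbT; apply/eqP => eqm.
  have m0 : (m - 1 = 0)%N.
    apply: (@GK_weight_boundary n (m - 1) be ga); first by lia.
    by rewrite -/c -/a -/b eqm E.
  by move: eqm lt; rewrite m0 mul0n; clear; lia.
case: hyp => [[l [be [ga [ml E]]]]|[_ [be [ga E]]]].
  exact: (GK_pole_witness hn2 hn hK hF Pinf_x P_x hmn ml E).
exact: (GK_pole_witness0 hn2 hn hK hF Pinf_x P_x P_y P_z hmn lt E).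
Qed.
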